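(* Let $\Delta=\{z\in\mathbb{C}:|z|<1\}$ and let $b\Delta=\{z\in\mathbb{C}:|z|=1\}$. A continuous function $f:b\Delta\to\mathbb{C}$ extends holomorphically through $\Delta$ if and only if, for each polynomial $P$ in one complex variable with complex coefficients such that $f(z)+P(z)\neq 0$ for all $z\in b\Delta$, the change of argument of $f+P$ around $b\Delta$ is nonnegative.
   Context: A continuous function $f$ on $b\Delta$ extends holomorphically through $\Delta$ if there is a continuous function on $\overline{\Delta}=\Delta\cup b\Delta$ that is holomorphic on $\Delta$ and equals $f$ on $b\Delta$. For a continuous nowhere zero function $g:b\Delta\to\mathbb{C}\setminus\{0\}$, the change of argument of $g$ around $b\Delta$ is the total change of a continuous branch of $\arg g(e^{i\theta})$ as $\theta$ goes from $0$ to $2\pi$ (counterclockwise), i.e. $2\pi$ times the winding number about $0$ of the closed curve $\theta\mapsto g(e^{i\theta})$, $0\le\theta\le 2\pi$. *)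

(* Defs.v *)
From mathcomp Require Import all_boot all_order all_algebra.
From mathcomp Require Import complex.
From mathcomp Require Import all_classical all_reals all_analysis.
Set Implicit Arguments.
Unset Strict Implicit.
Unset Printing Implicit Defensive.
Import Order.TTheory GRing.Theory Num.Theory.
Import numFieldNormedType.Exports.
Local Open Scope classical_set_scope.
Local Open Scope ring_scope.
Local Open Scope complex_scope.

(* The topology on the complex numbers is found through the alias [R[i]^o]:
   [R[i]] itself carries no canonical topological structure. *)
Notation Cplx R := ((R[i])^o).

Definition disc (R : realType) : set (Cplx R) := [set z | `|z| < 1].
Definition closed_disc (R : realType) : set (Cplx R) := [set z | `|z| <= 1].
Definition circle (R : realType) : set (Cplx R) := [set z | `|z| = 1].

Definition expi (R : realType) (t : R) : Cplx R := cos t +i* sin t.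

(* [derivable F z 1] is differentiability over the scalar field R[i], that is
   the existence of the limit of h^-1 * (F (h + z) - F z) as the complex
   number h tends to 0. *)
Definition holomorphic_on (R : realType) (D : set (Cplx R))
    (F : Cplx R -> Cplx R) : Prop :=
  forall z : Cplx R, D z -> derivable F z 1.

(* A function on the circle is given by a total function of which only the
   values on [circle] matter. *)
Definition extends_holomorphically (R : realType) (f : Cplx R -> Cplx R) :
    Prop :=
  exists F : Cplx R -> Cplx R,
    [/\ {within (@closed_disc R), continuous F},
        holomorphic_on (@disc R) F &
        forall z : Cplx R, circle z -> F z = f z].

Definition arg_branch (R : realType) (g : Cplx R -> Cplx R) (a : R -> R) :
    Prop :=
  {within `[0, 2 * pi], continuous a} /\
  forall t : R, t \in `[0, 2 * pi] ->
    g (expi t) = `|g (expi t)| * expi (a t).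

(* Stated as a relation; for g continuous and nowhere zero on the circle a
   branch exists and c does not depend on the branch. *)
Definition is_change_of_arg (R : realType) (g : Cplx R -> Cplx R) (c : R) :
    Prop :=
  exists2 a : R -> R, arg_branch g a & c = a (2 * pi) - a 0.

(* Main.v *)
(* A uniform limit of polynomials on the circle has a nonnegative change of
   argument, because a polynomial does; and [f] extends holomorphically iff it
   is such a limit.  If [f] is not, approximate it by a Laurent polynomial
   [s / z^N].  Among polynomials of degree [< N] choose [u] maximizing the ratio
   of the l2 norms of [s u mod z^N] and of [u], with minimal degree among the
   maximizers.  Then [u] has no zero in the closed disc, and
   [s u = y + z^N w] where [|y| = lambda |u|] on the circle, so that
   [s / z^N - w / u = y / (z^N u)] has constant modulus [lambda] and negative
   change of argument, [y] being of degree [< N].  If [lambda] is large, this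
   persists for [f - q] with [q] a polynomial close to [w / u], against the
   hypothesis; if it is small for arbitrarily fine approximations, then [f] is
   a uniform limit of polynomials after all.  Integrals are replaced throughout
   by averages over roots of unity. *)
Require Import Defs.
From mathcomp Require Import all_boot all_order all_algebra.
From mathcomp Require Import complex.
From mathcomp Require Import spectral sesquilinear.
From mathcomp Require Import all_classical all_reals all_analysis.
From mathcomp Require Import ring lra zify.
Set Implicit Arguments.
Unset Strict Implicit.
Unset Printing Implicit Defensive.
Import Order.TTheory GRing.Theory Num.Theory.
Import numFieldNormedType.Exports.
Import Normc.
Local Open Scope classical_set_scope.
Local Open Scope ring_scope.
Local Notation Re := complex.Re.
Local Notation Im := complex.Im.

(** * Modulus and topology of the complex numbers *)

(** The identity [|y| = lambda |u|] is pointwise although only norms are maximized. With [L] the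
    square of lambda and [A] multiplication by [s] modulo [X^N], a maximizer satisfies the linear
    equation [A^* A u = L u]. Since [A] commutes modulo [X^N] with multiplication by polynomials,
    testing this equation against [u / (1 - conj z X)] yields [|y|^2 = L |u|^2] at each point [z] of
    the circle. Minimal degree excludes roots in the closed disc because dividing out such a root
    leaves a maximizer.

    Without integrals, coefficients of polynomials are recovered exactly from finitely many nodes.
    For a function that is merely differentiable, Goursat's subdivision is run directly on Riemann
    sums. A dyadic polar grid replaces nested rectangles, and a block is called large when its sums
    are large for arbitrarily fine grids, since these sums are not known to converge. *)

Section Modulus.
Variable R : realType.
Implicit Types (x y z w : R[i]).

Lemma normcE z : `|z| = (normc z)%:C%C :> R[i].
Proof. by []. Qed.

Lemma normc_ge0 z : 0 <= normc z.
Proof. exact: (@normr_ge0 _ (Rcomplex R)). Qed.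

Lemma normc_sum (I : Type) (r : seq I) (P : pred I) (F : I -> R[i]) :
  normc (\sum_(i <- r | P i) F i) <= \sum_(i <- r | P i) normc (F i).
Proof. exact: (@ler_norm_sum _ (Rcomplex R)). Qed.

Lemma normcB x y : normc (x - y) = normc (y - x).
Proof. exact: (@distrC _ (Rcomplex R)). Qed.

Lemma normc_triangle z x y : normc (x - y) <= normc (x - z) + normc (z - y).
Proof. exact: (@ler_distD _ (Rcomplex R)). Qed.

Lemma normcX z n : normc (z ^+ n) = normc z ^+ n.
Proof. by elim: n => [|n IH]; rewrite ?normc1 // !exprS normcM IH. Qed.

Lemma normc_real (r : R) : normc r%:C%C = `|r|.
Proof. by rewrite /= expr0n /= addr0 sqrtr_sqr. Qed.

Lemma normc_nat n : normc (n%:R : R[i]) = n%:R.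
Proof. by rewrite -[n%:R in LHS](rmorph_nat (real_complex R)) normc_real ger0_norm. Qed.

Lemma normc_eq0 z : (normc z == 0) = (z == 0).
Proof. exact: (@normr_eq0 _ (Rcomplex R)). Qed.

Lemma normc_gt0 z : (0 < normc z) = (z != 0).
Proof. exact: (@normr_gt0 _ (Rcomplex R)). Qed.

Lemma normc_conj z : normc z^*%C = normc z.
Proof. by case: z => a b /=; rewrite sqrrN. Qed.

Lemma mul_conjc z : z * z^*%C = ((normc z) ^+ 2)%:C%C.
Proof. by rewrite rmorphXn /= -normcE sqr_normc. Qed.

Lemma normc_Re z : `|Re z| <= normc z.
Proof. by rewrite -lecR; exact: normc_ge_Re. Qed.

Lemma normc_Im z : `|Im z| <= normc z.
Proof. by case: z => a b /=; rewrite -sqrtr_sqr ler_wsqrtr // lerDr sqr_ge0. Qed.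

Lemma normc_ReIm z : normc z <= `|Re z| + `|Im z|.
Proof.
rewrite {1}[z]complexE (le_trans (le_normcD _ _)) // normcM !normc_real.
by rewrite /= expr0n expr1n /= add0r sqrtr1 mul1r.
Qed.

Lemma circleE z : circle z <-> normc z = 1.
Proof. by rewrite /circle /= normcE; split => [[]|->]. Qed.

Lemma closed_discE z : closed_disc z <-> normc z <= 1.
Proof. by rewrite /closed_disc /= normcE -[1]/(1%:C)%C lecR. Qed.

Lemma discE z : disc z <-> normc z < 1.
Proof. by rewrite /disc /= normcE -[1]/(1%:C)%C ltcR. Qed.

Lemma conjc_circle z : normc z = 1 -> z^*%C = z^-1.
Proof.
move=> z1; have z0 : z != 0 by rewrite -normc_gt0 z1.
by apply: (mulfI z0); rewrite mul_conjc z1 expr1n divff.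
Qed.

End Modulus.

Section Topology.
Variable R : realType.

Lemma nbhs_normcP (z : Cplx R) (A : set (Cplx R)) :
  nbhs z A <-> exists2 d : R, 0 < d & forall w, normc (w - z) < d -> A w.
Proof.
split=> [/nbhs_ballP[e /= e0 sA]|[d d0 sA]].
  have ed : e = (Re e)%:C%C by rewrite RRe_real // gtr0_real.
  rewrite ed -[0]/(0%:C)%C ltcR in e0.
  exists (Re e) => // w wz; apply: sA; rewrite /ball /=.
  by rewrite ed normcE ltcR normcB.
apply/nbhs_ballP; exists d%:C%C; first by rewrite /= -[0]/(0%:C)%C ltcR.
by move=> w; rewrite /ball /= normcE ltcR normcB => /sA.
Qed.

(** On a compact set this is continuity within the set. Moduli are taken in [R], where linear
    arithmetic applies, and not in [R[i]]. *)
Definition ucont (A : set (Cplx R)) (f : Cplx R -> Cplx R) : Prop :=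
  forall e : R, 0 < e -> exists2 d : R, 0 < d &
    forall z w, A z -> A w -> normc (z - w) < d -> normc (f z - f w) < e.

Lemma ucont_within A f : ucont A f -> {within A, continuous f}.
Proof.
move=> fu; apply/subspace_continuousP => z Az B /nbhs_normcP[e e0 eB].
have [d d0 fd] := fu e e0; apply/nbhs_normcP; exists d => // w wz Aw.
by apply: eB; exact: fd.
Qed.

(** Heine-Cantor. The near-covering form of compactness makes uniform over [A] a property of [d]
    that holds near each point for all small [d > 0]. *)
Lemma within_ucont A f : compact A -> {within A, continuous f} -> ucont A f.
Proof.
rewrite compact_near_coveringP => cA /subspace_continuousP fA e e0.
pose P (d : R) (z : Cplx R) := A z -> forall w, A w -> normc (z - w) < d ->
  normc (f z - f w) < e.
have : \forall d \near 0^'+, A `<=` P d.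
  apply: cA => z Az.
  have e2 : 0 < e / 2 by lra.
  have [|r r0 fr] := iffLR (nbhs_normcP z _) (fA z Az [set y | normc (y - f z) < e / 2] _).
    by apply/nbhs_normcP; exists (e / 2).
  have r2 : 0 < r / 2 by lra.
  exists ([set z' | normc (z' - z) < r / 2], [set d : R | d < r / 2]).
    split => /=; first by apply/nbhs_normcP; exists (r / 2).
    exact: nbhs_right_lt.
  move=> [z' d] /= [z'z dr] Az' w Aw z'w.
  have h1 : normc (f z' - f z) < e / 2 by apply: fr => //; lra.
  have h2 : normc (f w - f z) < e / 2.
    apply: fr => //; have := normc_triangle z' w z.
    by rewrite (normcB w z'); lra.
  by have := normc_triangle (f z) (f z') (f w); rewrite (normcB (f z) (f w)); lra.
move=> /nbhs_ballP[d /= d0 dP]; have d2 : 0 < d / 2 by lra.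
exists (d / 2) => // z w Az Aw zw; apply: (dP (d / 2) _ d2 z Az Az w Aw zw).
by rewrite /ball /= sub0r normrN gtr0_norm; lra.
Qed.

Lemma closed_disc_compact : compact (@closed_disc R).
Proof.
pose phi (p : R * R) : Cplx R := (p.1 +i* p.2)%C.
have phic : continuous phi.
  move=> p; apply/cvgrPdist_lt => e e0.
  have ed : e = (Re e)%:C%C by rewrite RRe_real // gtr0_real.
  rewrite ed -[0]/(0%:C)%C ltcR in e0.
  exists (ball p.1 (Re e / 2), ball p.2 (Re e / 2)) => /=.
    by split; apply: nbhsx_ballx; lra.
  move=> q [/= q1 q2]; rewrite ed normcE ltcR.
  rewrite (le_lt_trans (normc_ReIm _)) //=.
  by rewrite /ball /= in q1 q2; lra.
have sq : compact (phi @` (`[-1, 1] `*` `[-1, 1])).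
  apply: continuous_compact; first exact: continuous_subspaceT.
  by apply: compact_setX; exact: segment_compact.
apply: subclosed_compact sq _.
  rewrite closure_id eqEsubset; split; first exact: subset_closure.
  move=> z zcl; apply/closed_discE; rewrite leNgt; apply/negP => z1.
  have [|w [/closed_discE w1 /= wz]] := zcl [set w : Cplx R | normc (w - z) < normc z - 1].
    by apply/nbhs_normcP; exists (normc z - 1) => //; lra.
  have := normc_triangle w z 0; rewrite !subr0 (normcB z).
  lra.
move=> z /closed_discE z1; exists (Re z, Im z); last by case: z {z1}.
have := normc_Re z; have := normc_Im z; rewrite !ler_norml /= !in_itv /=.
by move=> /andP[? ?] /andP[? ?]; split; apply/andP; split; lra.
Qed.

Lemma circle_compact : compact (@circle R).
Proof.
apply: subclosed_compact closed_disc_compact _; last first.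
  by move=> z /circleE z1; apply/closed_discE; rewrite z1.
rewrite closure_id eqEsubset; split; first exact: subset_closure.
move=> z zcl; apply/circleE/eqP/negPn/negP => z1.
have z1' : 0 < `|normc z - 1| by rewrite normr_gt0 subr_eq0.
have [|w [/circleE w1 /= wz]] := zcl [set w : Cplx R | normc (w - z) < `|normc z - 1|].
  by apply/nbhs_normcP; exists `|normc z - 1|.
have := normc_triangle w z 0; have := normc_triangle z w 0.
rewrite !subr0 (normcB z) w1 => h1 h2.
by move: wz; rewrite ltNge => /negP; apply; rewrite ler_norml; apply/andP; split; lra.
Qed.

(** A derivative without quotients: the weak inequality admits [w = z], and the remainder after the
    affine part is the quantity that Goursat's argument estimates. *)
Definition complex_differentiable (F : R[i] -> R[i]) (z : R[i]) :=
  exists l : R[i], forall e : R, 0 < e ->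
    exists2 d : R, 0 < d & forall w, normc (w - z) < d ->
      normc (F w - F z - l * (w - z)) <= e * normc (w - z).

Lemma derivable_normcP (F : Cplx R -> Cplx R) (z : Cplx R) :
  derivable F z 1 <-> complex_differentiable F z.
Proof.
split=> [|[l lP]].
  move=> dF; pose l : Cplx R := lim ((fun h : Cplx R => h^-1 *: (F (h *: (1 : Cplx R) + z) - F z)) @ 0^').
  exists l => e e0; have := dF => /cvgrPdist_lt /(_ e%:C%C).
  rewrite -[0]/(0%:C)%C ltcR => /(_ e0) /nbhs_normcP[d d0 dl].
  exists d => // w wz; have [->|wz0] := eqVneq w z.
    by rewrite !subrr mulr0 subr0 normc0 mulr0.
  have wz1 : w - z != 0 by rewrite subr_eq0.
  have := dl (w - z); rewrite subr0 => /(_ wz wz1).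
  rewrite -/l normcE ltcR /GRing.scale /= mulr1 subrK => /ltW.
  rewrite -(ler_pM2r (x := normc (w - z))) ?normc_gt0 // -normcM mulrBl mulrAC.
  by rewrite mulVf // mul1r normcB.
apply: cvgP; apply: (_ : _ --> (l : Cplx R)). apply/cvgrPdist_lt => e e0.
have ed : e = (Re e)%:C%C by rewrite RRe_real // gtr0_real.
rewrite ed -[0]/(0%:C)%C ltcR in e0 *.
have e20 : 0 < Re e / 2 by lra.
have [d d0 dl] := lP _ e20.
apply/nbhs_normcP; exists d => // h; rewrite subr0 => hd h0.
rewrite normcE ltcR /GRing.scale /= mulr1.
have := dl (h + z); rewrite addrK => /(_ hd) dlh.
have hh : 0 < normc h by rewrite normc_gt0.
suff : normc (l - h^-1 * (F (h + z) - F z)) <= Re e / 2 by move: e0 e20; lra.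
rewrite -(ler_pM2r hh) -normcM mulrBl mulrAC.
by rewrite mulVf // mul1r normcB.
Qed.

End Topology.

(** * Change of argument *)

Section Winding.
Variable R : realType.
Implicit Types (g h k : Cplx R -> Cplx R) (s t : R).

Lemma expiD s t : expi (s + t) = expi s * expi t.
Proof. by rewrite /expi cosD sinD; congr Complex; ring. Qed.

Lemma expi0 : expi (0 : R) = 1.
Proof. by rewrite /expi cos0 sin0. Qed.

Lemma expiN t : expi (- t) = (expi t)^*%C.
Proof. by rewrite /expi cosN sinN. Qed.

Lemma normc_expi t : normc (expi t) = 1.
Proof. by rewrite /= cos2Dsin2 sqrtr1. Qed.

Lemma expi_neq0 t : expi t != 0.
Proof. by rewrite -normc_gt0 normc_expi. Qed.

Lemma expiV t : (expi t)^-1 = expi (- t).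
Proof. by rewrite expiN conjc_circle ?normc_expi. Qed.

Lemma expi2pi : expi (2 * pi) = 1 :> Cplx R.
Proof. by rewrite /expi mulr_natl cos2pi sin2pi. Qed.

Lemma expi_circle t : circle (expi t).
Proof. by apply/circleE; exact: normc_expi. Qed.

Lemma expiM t n : expi (n%:R * t) = expi t ^+ n.
Proof.
elim: n => [|n IH]; first by rewrite mul0r expi0.
by rewrite -addn1 natrD mulrDl mul1r expiD IH addn1 exprSr.
Qed.

Lemma continuous_expi : continuous (@expi R).
Proof.
move=> t A /nbhs_normcP[e e0 eA].
have e2 : 0 < e / 2 by lra.
have /cvgrPdist_lt /(_ _ e2) c := @continuous_cos R t.
have /cvgrPdist_lt /(_ _ e2) s := @continuous_sin R t.
change (\forall u \near t, A (expi u)).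
near=> u; apply: eA; rewrite normcB (le_lt_trans (normc_ReIm _)) //=.
have : `|cos t - cos u| < e / 2 by near: u.
have : `|sin t - sin u| < e / 2 by near: u.
by lra.
Unshelve. all: by end_near. Qed.

Lemma polar (z : R[i]) : exists t, z = (normc z)%:C%C * expi t.
Proof.
wlog z1 : z / normc z = 1.
  move=> H; have [->|z0] := eqVneq z 0; first by exists 0; rewrite normc0 mul0r.
  have nz : (normc z)%:C%C != 0 :> R[i].
    by rewrite -normc_gt0 normc_real normr_gt0 normc_eq0.
  have [|t zt] := H (z / (normc z)%:C%C).
    by rewrite normcM normcV normc_real ger0_norm ?normc_ge0 // divff // normc_eq0.
  exists t; move: zt; rewrite normcM normcV normc_real ger0_norm ?normc_ge0 //.
  by rewrite divff ?normc_eq0 // mul1r => <-; rewrite mulrC divfK.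
rewrite z1; case: z z1 => x y /= n1.
have xy : x ^+ 2 + y ^+ 2 = 1.
  by rewrite -[LHS]sqr_sqrtr ?n1 ?expr1n // addr_ge0 ?sqr_ge0.
have x1 : -1 <= x <= 1.
  rewrite -ler_norml -(ler_pXn2r (n := 2)) ?nnegrE // expr1n -normrX.
  by rewrite ger0_norm ?sqr_ge0 //; have := sqr_ge0 y; lra.
have sq : Num.sqrt (1 - x ^+ 2) = `|y| by rewrite -sqrtr_sqr; congr Num.sqrt; lra.
have [y0|y0] := ger0P y; [exists (acos x)|exists (- acos x)];
  rewrite mul1r /expi ?sinN ?cosN acosK ?in_itv //= sin_acos // sq.
  by rewrite ger0_norm.
by rewrite ltr0_norm // opprK.
Qed.

Definition ccont g := continuous (fun t : R => g (expi t)).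

Lemma ucont_ccont g : ucont (@circle R) g -> ccont g.
Proof.
move=> gu t A /nbhs_normcP[e e0 eA].
have [d d0 gd] := gu e e0.
have /continuous_expi dE : nbhs (expi t) [set w : Cplx R | normc (w - expi t) < d].
  by apply/nbhs_normcP; exists d.
change (\forall u \near t, A (g (expi u))).
near=> u; apply: eA; apply: gd; try exact: expi_circle.
by near: u.
Unshelve. all: by end_near. Qed.

Lemma ccont_id : ccont id.
Proof. exact: continuous_expi. Qed.

Lemma ccont_cst (c : Cplx R) : ccont (fun _ => c).
Proof. by move=> t; exact: cvg_cst. Qed.

Lemma ccontD g h : ccont g -> ccont h -> ccont (fun z => g z + h z).
Proof. by move=> cg ch t; apply: (@cvgD R[i]); [exact: cg|exact: ch]. Qed.

Lemma ccontM g h : ccont g -> ccont h -> ccont (fun z => g z * h z).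
Proof. by move=> cg ch t; apply: (@cvgM R[i]); [exact: cg|exact: ch]. Qed.

Lemma ccontV g : ccont g -> (forall z, circle z -> g z != 0) ->
  ccont (fun z => (g z)^-1).
Proof.
move=> cg g0 t; apply: (@cvgV R[i]); [apply: g0; exact: expi_circle|exact: cg].
Qed.

Lemma ccont_horner (p : {poly R[i]}) : ccont (fun z => p.[z]).
Proof.
elim/poly_ind: p => [|p c IH].
  have -> : (fun z : Cplx R => (0 : {poly R[i]}).[z]) = (fun _ => 0).
    by apply/funext => z; rewrite horner0.
  exact: ccont_cst.
have -> : (fun z : Cplx R => (p * 'X + c%:P).[z]) = (fun z => p.[z] * z + c).
  by apply/funext => z; rewrite !hornerE.
apply: ccontD; last exact: ccont_cst.
exact: (ccontM IH ccont_id).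
Qed.

Lemma continuous_Re : continuous (fun z : Cplx R => Re z).
Proof.
move=> z A /nbhs_ballP[e /= e0 eA]; apply/nbhs_normcP; exists e => // w wz.
apply: eA; rewrite /ball /= (le_lt_trans _ wz) // normcB.
by case: z w {wz} => [x y] [x' y']; exact: normc_Re (Complex (x - x') (y - y')).
Qed.

Lemma continuous_Im : continuous (fun z : Cplx R => Im z).
Proof.
move=> z A /nbhs_ballP[e /= e0 eA]; apply/nbhs_normcP; exists e => // w wz.
apply: eA; rewrite /ball /= (le_lt_trans _ wz) // normcB.
by case: z w {wz} => [x y] [x' y']; exact: normc_Im (Complex (x - x') (y - y')).
Qed.

Lemma change_ext g h c : (forall z, circle z -> g z = h z) ->
  is_change_of_arg g c -> is_change_of_arg h c.
Proof.
move=> gh [a [ac ga] ->]; exists a => //; split=> // t tI.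
by rewrite -gh; [exact: ga|exact: expi_circle].
Qed.

Lemma change_mul g h c d : is_change_of_arg g c -> is_change_of_arg h d ->
  is_change_of_arg (fun z => g z * h z) (c + d).
Proof.
move=> [a [ac ga] ->] [b [bc hb] ->]; exists (a + b); last by rewrite !fctE; lra.
split; first exact: within_continuousD.
by move=> t tI; rewrite normrM !fctE expiD mulrACA -(ga t tI) -(hb t tI).
Qed.

Lemma change_inv g c : is_change_of_arg g c ->
  is_change_of_arg (fun z => (g z)^-1) (- c).
Proof.
move=> [a [ac ga] ->]; exists (- a); last by rewrite !fctE; lra.
split; first by move=> t; apply: cvgN; exact: ac.
move=> t tI; rewrite normfV [in LHS](ga t tI) invfM !fctE.
by rewrite -expiV.
Qed.

Lemma change_cst (c : R[i]) : is_change_of_arg (fun _ => c) 0.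
Proof.
have [t ct] := polar c; exists (fun _ => t); last by rewrite subrr.
by split=> [|s _]; [exact: cst_continuous|exact: ct].
Qed.

Lemma change_id : is_change_of_arg (@id (Cplx R)) (2 * pi).
Proof.
exists id; last by rewrite subr0.
split=> [|s _]; first by apply: continuous_subspaceT => t; exact: cvg_id.
by rewrite normcE normc_expi mul1r.
Qed.

(** The principal argument [atan (Im / Re)] is continuous on the half plane, and it returns to its
    initial value because it depends on the point [expi t] only. *)
Lemma change_right_half_plane k : ccont k ->
  (forall z, circle z -> 0 < Re (k z)) -> is_change_of_arg k 0.
Proof.
move=> kc k0.
pose a t := atan (Im (k (expi t)) / Re (k (expi t))).
exists a; last by rewrite /a expi2pi expi0 subrr.
split=> [|t _].
  apply: continuous_subspaceT => t.
  apply: (@continuous_comp _ _ _ (fun t => Im (k (expi t)) / Re (k (expi t))));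
    last exact: continuous_atan.
  apply: cvgM.
    exact: (@continuous_comp _ _ _ (fun t => k (expi t)) (fun z : Cplx R => Im z) t (kc t)
      (@continuous_Im _)).
  apply: cvgV; first by rewrite gt_eqF // k0 //; exact: expi_circle.
  exact: (@continuous_comp _ _ _ (fun t => k (expi t)) (fun z : Cplx R => Re z) t (kc t)
      (@continuous_Re _)).
have := k0 _ (expi_circle t); rewrite /a normcE.
case: (k (expi t)) => x y /= x0.
set v := y / x; have yE : y = x * v by rewrite /v mulrC divfK ?gt_eqF.
have v1 : 0 < Num.sqrt (1 + v ^+ 2) by rewrite sqrtr_gt0; have := sqr_ge0 v; lra.
have nE : Num.sqrt (x ^+ 2 + y ^+ 2) = x * Num.sqrt (1 + v ^+ 2).
  transitivity (Num.sqrt (x ^+ 2) * Num.sqrt (1 + v ^+ 2)); last first.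
    by rewrite sqrtr_sqr ger0_norm // ltW.
  by rewrite -sqrtrM ?sqr_ge0 // yE; congr Num.sqrt; ring.
have cE : cos (atan v) = (Num.sqrt (1 + v ^+ 2))^-1 by rewrite cos_atan.
have c0 : cos (atan v) != 0 by rewrite cE invr_neq0 // gt_eqF.
have sE : sin (atan v) = v * cos (atan v) by rewrite -{2}(atanK v) /tan divfK.
rewrite nE /expi sE cE yE; apply/eqP; rewrite eq_complex /=.
by apply/andP; split; apply/eqP; field; rewrite gt_eqF.
Qed.

(** Rouche's theorem: [g / h] stays within distance 1 of 1, hence in the right half plane. *)
Lemma change_near g h c : ccont g -> ccont h ->
  (forall z, circle z -> normc (g z - h z) < normc (h z)) ->
  is_change_of_arg h c -> is_change_of_arg g c.
Proof.
move=> gc hc gh hchg.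
have h0 z : circle z -> h z != 0.
  by move=> /gh; rewrite -normc_gt0; apply: le_lt_trans; exact: normc_ge0.
have kch : is_change_of_arg (fun z => g z * (h z)^-1) 0.
  apply: change_right_half_plane => [|z zc].
    exact: (ccontM gc (ccontV hc h0)).
  set k := g z / h z; have gE : g z = k * h z by rewrite divfK ?h0.
  have := gh z zc; have -> : g z - h z = (k - 1) * h z by rewrite gE; ring.
  rewrite normcM -[ltRHS]mul1r ltr_pM2r ?normc_gt0 ?h0 // => k1.
  have := le_lt_trans (normc_Re _) k1; rewrite raddfB /= ltr_norml => /andP[].
  by rewrite /=; lra.
have := change_mul hchg kch; rewrite addr0; apply: change_ext => z zc.
by rewrite mulrC divfK ?h0.
Qed.

(** By [change_near], against the dominating term on the circle: [z] or [- r]. *)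
Lemma change_linear (r : R[i]) : normc r != 1 ->
  is_change_of_arg (fun z => z - r) (if normc r < 1 then 2 * pi else 0).
Proof.
move=> r1; case: ifPn => [rlt|rge].
  apply: (@change_near _ id); last exact: change_id.
  - by apply: ccontD; [exact: ccont_id|exact: ccont_cst].
  - exact: ccont_id.
  move=> z /circleE z1; rewrite z1.
  have -> : z - r - id z = - r by rewrite /=; ring.
  by rewrite normcN.
apply: (@change_near _ (fun _ => - r)); last exact: change_cst.
- by apply: ccontD; [exact: ccont_id|exact: ccont_cst].
- exact: ccont_cst.
move=> z /circleE z1; have -> : z - r - - r = z by ring.
rewrite normcN z1.
by rewrite lt_def r1 leNgt.
Qed.

(** The witness counts the roots in the open disc with multiplicity. The bound by the size serves
    for [y], the last clause for [u]. *)
Lemma change_poly (p : {poly R[i]}) : (forall z, circle z -> p.[z] != 0) ->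
  exists n, [/\ is_change_of_arg (fun z => p.[z]) (2 * pi * n%:R),
    (n < size p)%N &
    ((forall z, root p z -> 1 < normc z) -> n = 0%N)].
Proof.
move=> p0; have [rs prs] := closed_field_poly_normal p.
have pn0 : p != 0.
  by apply/eqP => pE; have := p0 _ (expi_circle 0); rewrite pE horner0 eqxx.
have rt z : z \in rs -> root p z.
  by move=> zr; rewrite prs rootZ ?lead_coef_eq0 // root_prod_XsubC.
have r1 z : z \in rs -> normc z != 1.
  move=> /rt pz; apply/eqP => z1; have /p0 : circle z by apply/circleE.
  by rewrite -[_ != _]/(~~ root p z) pz.
exists (count (fun r : R[i] => normc r < 1) rs); split; last first.
- move=> pr; apply/eqP; rewrite -leqn0 leqNgt -has_count; apply/hasP => -[r /rt/pr].
  by move=> h1 /(lt_trans h1); rewrite ltxx.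
- rewrite prs size_scale ?lead_coef_eq0 // size_prod_XsubC ltnS; exact: count_size.
suff H : is_change_of_arg (fun z => (\prod_(r <- rs) ('X - r%:P)).[z])
    (2 * pi * (count (fun r : R[i] => normc r < 1) rs)%:R).
  have := change_mul (change_cst (lead_coef p)) H; rewrite add0r.
  by apply: change_ext => z _; rewrite {2}prs hornerZ.
elim: rs r1 {prs rt} => [_|r rs IH r1].
  rewrite mulr0; apply: change_ext (change_cst 1) => z _.
  by rewrite big_nil hornerC.
have := change_mul (change_linear (r1 r (mem_head _ _))) (IH _).
have -> : (if normc r < 1 then 2 * pi else 0) +
  2 * pi * (count (fun r : R[i] => normc r < 1) rs)%:R =
  2 * pi * (count (fun r : R[i] => normc r < 1) (r :: rs))%:R :> R.
  rewrite -[count _ (r :: rs)]/((normc r < 1)%R + count _ rs)%N natrD.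
  by move: (2 * @pi R) => c; case: (normc r < 1); rewrite /nat_of_bool; ring.
move=> H; apply: change_ext (H _) => [z _|z zr]; last by apply: r1; rewrite inE zr orbT.
by rewrite big_cons hornerM hornerXsubC.
Qed.

Lemma change_unique g c d : (forall z, circle z -> g z != 0) ->
  is_change_of_arg g c -> is_change_of_arg g d -> c = d.
Proof.
wlog : c d / c < d => [H g0 gc gd|cd g0].
  by have [cd|dc|//] := ltgtP c d; [exact: H|apply/esym; exact: H].
move=> [a [ac ga] cE] [b [bc gb] dE]; exfalso.
pose u := b - a.
have uc : {within `[0, 2 * pi], continuous u} by exact: within_continuousB.
have u1 t : t \in `[0, 2 * pi] -> expi (u t) = 1.
  move=> tI; have gt0 := g0 _ (expi_circle t).
  have : expi (b t) = expi (a t).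
    apply: (mulfI (x := `|g (expi t)|)); first by rewrite normr_eq0.
    by rewrite -(ga t tI) -(gb t tI).
  by rewrite /u !fctE expiD expiN => ->; rewrite mulrC -expiN -expiV mulVf ?expi_neq0.
have pi2 : 0 <= 2 * pi :> R by have := pi_ge0 R; lra.
have u02 : u 0 < u (2 * pi) by rewrite /u !fctE; lra.
(* The difference [u] of two branches only takes values with [expi (u t) = 1]. A value [v] at most 1
   above [u 0] has [v - u 0] in []0, pi[], where the sine is positive; any bound below [pi] would
   do. *)
pose v := Num.min (u (2 * pi)) (u 0 + 1).
have v0 : u 0 < v by rewrite /v lt_min u02 ltrDl ltr01.
have v1 : v <= u 0 + 1 by rewrite /v ge_min lexx orbT.
have v2 : v <= u (2 * pi) by rewrite /v ge_min lexx.
have [|x xI ux] := IVT (v := v) pi2 uc.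
  by rewrite ge_min le_max v2 (ltW v0) orbT.
have e1 : expi (v - u 0) = 1.
  by rewrite expiD -expiV -ux !u1 ?invr1 ?mulr1 // in_itv /= lexx.
have p2 := @pi_ge2 R.
have q1 : 0 < v - u 0 by lra.
have q2 : v - u 0 < pi by lra.
have := @sin_gt0_pi R (v - u 0); rewrite q1 q2 => /(_ isT).
by case: e1 => _ ->; rewrite ltxx.
Qed.

End Winding.

(** * Polynomials on the circle *)

Section PolynomialsOnTheCircle.
Variable R : realType.
Implicit Types (p q : {poly R[i]}) (z w a : R[i]).

Definition unity_root (M : nat) : R[i] := expi (2 * pi / M%:R).

Lemma normc_unity_root M : normc (unity_root M) = 1.
Proof. exact: normc_expi. Qed.

Lemma unity_root_neq0 M : unity_root M != 0.
Proof. exact: expi_neq0. Qed.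

Lemma unity_rootX M : (0 < M)%N -> unity_root M ^+ M = 1.
Proof.
move=> M0; rewrite /unity_root -expiM mulrC divfK ?pnatr_eq0 -?lt0n //.
exact: expi2pi.
Qed.

Lemma unity_rootX_neq1 M j : (0 < j < M)%N -> unity_root M ^+ j != 1.
Proof.
move=> /andP[j0 jM]; have M0 : (0 < M)%N by apply: leq_trans jM.
rewrite /unity_root -expiM.
(* Half the angle lies in []0, pi[], where the sine is positive, while [cos (x + x) = 1] would force
   it to vanish. *)
pose x : R := pi * (j%:R / M%:R).
have -> : j%:R * (2 * pi / M%:R) = x + x by rewrite /x; ring.
have x0 : 0 < x by rewrite mulr_gt0 ?pi_gt0 ?divr_gt0 ?ltr0n.
have xpi : x < pi.
  by rewrite gtr_pMr ?pi_gt0 // ltr_pdivrMr ?ltr0n // mul1r ltr_nat.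
have := @sin_gt0_pi R x; rewrite x0 xpi => /(_ isT) s0.
apply/eqP => -[+ _]; rewrite cosD => c.
have := cos2Dsin2 x; have : 0 < sin x * sin x by rewrite mulr_gt0.
by rewrite !expr2; lra.
Qed.

Lemma unity_root_orth M i j : (i < M)%N -> (j < M)%N ->
  \sum_(k < M) (unity_root M ^+ k) ^+ i * ((unity_root M ^+ k) ^+ j)^*%C =
  if i == j then M%:R else 0.
Proof.
wlog ij : i j / (j <= i)%N => [H iM jM|iM jM].
  have [ji|ij] := leqP j i; first exact: H.
  have := H _ _ (ltnW ij) jM iM; rewrite eq_sym.
  move=> /(congr1 (@conjc R)); rewrite rmorph_sum /= => E.
  transitivity (\sum_(k < M) ((unity_root M ^+ k) ^+ j * ((unity_root M ^+ k) ^+ i)^*)^*%C).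
    by apply: eq_bigr => k _; rewrite rmorphM /= conjcK mulrC.
  by rewrite E; case: ifP => _; rewrite ?conjc_nat ?conjc0.
have H (k : 'I_M) : (unity_root M ^+ k) ^+ i * ((unity_root M ^+ k) ^+ j)^*%C =
    (unity_root M ^+ (i - j)) ^+ k.
  rewrite conjc_circle; last by rewrite !normcX normc_unity_root !expr1n.
  rewrite -{1}(subnK ij) exprD mulfK ?expf_neq0 ?unity_root_neq0 //.
  by rewrite -!exprM mulnC.
rewrite (eq_bigr _ (fun k _ => H k)); have [->|nij] := eqVneq i j.
  rewrite subnn (eq_bigr (fun=> 1)) ?sumr_const ?card_ord // => k _.
  by rewrite expr0 expr1n.
have M0 : (0 < M)%N by apply: leq_ltn_trans iM.
have n1 : unity_root M ^+ (i - j) - 1 != 0.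
  rewrite subr_eq0 unity_rootX_neq1 // subn_gt0 ltn_neqAle eq_sym nij ij /=.
  exact: leq_ltn_trans (leq_subr _ _) iM.
apply: (mulfI n1); rewrite -subrX1 mulr0 exprAC unity_rootX // expr1n subrr //.
Qed.

(** Exact since [M] nodes separate the frequencies below [M]. The rotation [c] of the nodes serves
    twice: to centre the Fejer kernel at a point and to keep the nodes away from a root. *)
Lemma coef_avg p M j (c : R[i]) : normc c = 1 -> (size p <= M)%N -> (j < M)%N ->
  M%:R * p`_j =
  \sum_(k < M) p.[c * unity_root M ^+ k] * ((c * unity_root M ^+ k) ^+ j)^*%C.
Proof.
move=> c1 pM jM.
under eq_bigr => k _ do rewrite (horner_coef_wide _ pM) mulr_suml.
rewrite exchange_big /=.
transitivity (\sum_(i < M) p`_i * (c ^+ i * (c ^+ j)^*%C) * (if val i == j then M%:R else 0)).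
  rewrite (bigD1 (Ordinal jM)) //= eqxx big1 => [|i /negPf ij]; last first.
    by move: ij; rewrite -val_eqE /= => ->; rewrite mulr0.
  by rewrite mul_conjc normcX c1 !expr1n mulr1 addr0 mulrC.
apply: eq_bigr => i _; rewrite -(unity_root_orth (ltn_ord i) jM) mulr_sumr.
apply: eq_bigr => k _; rewrite !exprMn rmorphM /=; ring.
Qed.

Lemma parseval p M (c : R[i]) : normc c = 1 -> (size p <= M)%N ->
  \sum_(k < M) normc (p.[c * unity_root M ^+ k]) ^+ 2 =
  M%:R * \sum_(i < M) normc p`_i ^+ 2.
Proof.
move=> c1 pM; apply: complexI; rewrite rmorphM !rmorph_sum rmorph_nat /=.
under eq_bigr => k _ do
  rewrite -mul_conjc {2}(horner_coef_wide _ pM) rmorph_sum /= mulr_sumr.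
rewrite exchange_big mulr_sumr /=; apply: eq_bigr => j _.
rewrite -mul_conjc mulrA (coef_avg c1 pM (ltn_ord j)) mulr_suml.
by apply: eq_bigr => k _; rewrite rmorphM /=; ring.
Qed.

Lemma coef_bound p (m : R) : (forall z, normc z = 1 -> normc p.[z] <= m) ->
  forall j, normc p`_j <= m.
Proof.
move=> pm j; have m0 : 0 <= m by apply: le_trans (pm 1 (normc1 _)); exact: normc_ge0.
pose M := (maxn (size p) j.+1).
have pM : (size p <= M)%N by rewrite leq_maxl.
have jM : (j < M)%N by rewrite leq_maxr.
have M0 : 0 < M%:R :> R by rewrite ltr0n; apply: leq_trans jM.
rewrite -(ler_pM2l M0) -{1}(@normc_nat R M) -normcM (coef_avg (normc1 R) pM jM).
apply: le_trans (normc_sum _ _ _) _.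
have -> : M%:R * m = \sum_(k < M) m by rewrite sumr_const card_ord mulr_natl.
apply: ler_sum => k _; rewrite normcM normc_conj normcX.
have c1 : normc (1 * unity_root M ^+ k) = 1.
  by rewrite mul1r normcX normc_unity_root expr1n.
by rewrite c1 expr1n mulr1 pm.
Qed.

Lemma geometric_le (x : R) n : 0 <= x < 1 -> \sum_(i < n) x ^+ i <= (1 - x)^-1.
Proof.
move=> /andP[x0 x1]; have d0 : 0 < 1 - x by lra.
rewrite -(ler_pM2l d0) divff ?gt_eqF // -[1 - x]opprB mulNr -subrX1 opprB.
by rewrite gerBl exprn_ge0.
Qed.

Lemma expr_small (x e : R) : 0 <= x < 1 -> 0 < e -> exists n, x ^+ n < e.
Proof.
move=> /andP[x0 x1] e0.
have : (fun n => x ^+ n) @ \oo --> (0 : R) by apply: cvg_expr; rewrite ger0_norm.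
move=> /cvgrPdist_lt /(_ e e0) [n _ /(_ n (leqnn _))] /=.
by rewrite sub0r normrN ger0_norm ?exprn_ge0 // => H; exists n.
Qed.

(* The crude bound [m / (1 - |a|)] applied to all powers of [p] loses its
   constant in the limit. *)
Lemma max_principle p (m : R) : (forall z, normc z = 1 -> normc p.[z] <= m) ->
  forall a, normc a <= 1 -> normc p.[a] <= m.
Proof.
move=> pm a; rewrite le_eqVlt => /predU1P[/pm//|a1].
have m0 : 0 <= m by apply: le_trans (pm 1 (normc1 _)); exact: normc_ge0.
have a0 := normc_ge0 a; have y0 := normc_ge0 p.[a].
have H n : normc p.[a] ^+ n <= m ^+ n * (1 - normc a)^-1.
  rewrite -normcX -horner_exp horner_coef.
  apply: le_trans (normc_sum _ _ _) _.
  apply: le_trans (_ : m ^+ n * \sum_(i < size (p ^+ n)) normc a ^+ i <= _).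
    rewrite mulr_sumr; apply: ler_sum => i _; rewrite normcM normcX.
    rewrite ler_wpM2r ?exprn_ge0 // coef_bound // => z z1.
    by rewrite horner_exp normcX lerXn2r ?nnegrE ?normc_ge0 ?pm.
  by rewrite ler_wpM2l ?exprn_ge0 // geometric_le // a0.
rewrite leNgt; apply/negP => my.
have yp : 0 < normc p.[a] by lra.
have d0 : 0 < 1 - normc a by lra.
have [|n] := @expr_small (m / normc p.[a]) (1 - normc a) _ d0.
  by rewrite divr_ge0 //= ltr_pdivrMr // mul1r.
rewrite expr_div_n ltr_pdivrMr ?exprn_gt0 //; have := H n.
by rewrite ler_pdivlMr // mulrC => h1 h2; lra.
Qed.

End PolynomialsOnTheCircle.

(** * Uniform limits of polynomials on the circle: products and inverses *)

Section Approximable.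
Variable R : realType.
Implicit Types (f g : Cplx R -> Cplx R).

Definition approximable f := forall e : R, 0 < e ->
  exists p : {poly R[i]}, forall z, circle z -> normc (f z - p.[z]) < e.

Lemma approximable_poly (p : {poly R[i]}) : approximable (fun z => p.[z]).
Proof. by move=> e e0; exists p => z _; rewrite subrr normc0. Qed.

Lemma approximable_limit f : (forall e : R, 0 < e -> exists2 g, approximable g &
  forall z, circle z -> normc (f z - g z) < e) -> approximable f.
Proof.
move=> fg e e0; have e2 : 0 < e / 2 by lra.
have [g /(_ _ e2)[p gp] fge] := fg _ e2.
exists p => z zc; have := normc_triangle (g z) (f z) p.[z].
by have := gp z zc; have := fge z zc; lra.
Qed.

Lemma poly_bounded (p : {poly R[i]}) : exists2 B : R, 0 < B &
  forall z, circle z -> normc p.[z] <= B.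
Proof.
exists (1 + \sum_(i < size p) normc p`_i).
  by rewrite ltr_wpDr // sumr_ge0 // => i _; exact: normc_ge0.
move=> z /circleE z1; rewrite horner_coef.
apply: le_trans (normc_sum _ _ _) _; apply: ler_wpDl => //.
by apply: ler_sum => i _; rewrite normcM normcX z1 expr1n mulr1.
Qed.

Lemma approximableM f g : approximable f -> approximable g ->
  approximable (fun z => f z * g z).
Proof.
move=> fa ga e e0.
(* The approximant [q0] only serves to bound [g]. The final [q] comes after [p], whose bound [C]
   sets its tolerance. *)
have [q0 gq0] := ga 1 ltr01; have [B B0 qB] := poly_bounded q0.
have [p fp] := fa (e / 2 / (B + 1)) ltac:(by rewrite !divr_gt0 //; lra).
have [C C0 pC] := poly_bounded p.
have [q gq] := ga (e / 2 / C) ltac:(by rewrite !divr_gt0 //; lra).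
exists (p * q) => z zc; rewrite hornerM.
have -> : f z * g z - p.[z] * q.[z] =
  (f z - p.[z]) * g z + p.[z] * (g z - q.[z]) by ring.
apply: le_lt_trans (le_normcD _ _) _; rewrite !normcM.
have gB : normc (g z) <= B + 1.
  have := normc_triangle q0.[z] (g z) 0; rewrite !subr0.
  by have := gq0 z zc; have := qB z zc; lra.
have h1 : normc (f z - p.[z]) * normc (g z) < e / 2.
  apply: le_lt_trans (ler_wpM2l (normc_ge0 _) gB) _.
  by rewrite -ltr_pdivlMr ?fp //; lra.
have h2 : normc p.[z] * normc (g z - q.[z]) <= e / 2.
  apply: le_trans (ler_wpM2r (normc_ge0 _) (pC z zc)) _.
  by rewrite mulrC -ler_pdivlMr // ltW ?gq.
lra.
Qed.

Lemma approximable_linearV (a : R[i]) : 1 < normc a ->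
  approximable (fun z => (z - a)^-1).
Proof.
move=> a1 e e0; have a0 : a != 0 by rewrite -normc_gt0; lra.
have na0 : 0 < normc a by lra.
have t01 : 0 <= (normc a)^-1 < 1 by rewrite invr_ge0 (ltW na0) invf_lt1.
have na1 : 0 < normc a - 1 by lra.
(* The geometric series in [z / a], cut at [n], has error [(z / a)^n / (z - a)], of modulus at most
   [|a|^-n / (|a| - 1)] on the circle. *)
have [n ne] := expr_small t01 (mulr_gt0 e0 na1).
exists (- a^-1 *: \sum_(i < n) (a^-1 *: 'X) ^+ i) => z /circleE z1.
rewrite hornerZ horner_sum.
under eq_bigr => i _ do rewrite horner_exp hornerZ hornerX.
have za : z - a != 0.
  by apply/eqP => /eqP; rewrite subr_eq0 => /eqP E; rewrite E in z1; lra.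
have -> : (z - a)^-1 - - a^-1 * \sum_(i < n) (a^-1 * z) ^+ i =
   (a^-1 * z) ^+ n / (z - a).
  have -> : (a^-1 * z) ^+ n =
    1 + (a^-1 * z - 1) * \sum_(i < n) (a^-1 * z) ^+ i by rewrite -subrX1; ring.
  by field; rewrite za.
rewrite normcM normcX normcM !normcV z1 mulr1.
have d : normc a - 1 <= normc (z - a).
  by have := normc_triangle z a 0; rewrite !subr0 (normcB a); lra.
rewrite ltr_pdivrMr ?normc_gt0 //; apply: lt_le_trans ne _.
by rewrite ler_wpM2l // ltW.
Qed.

Lemma approximable_polyV (p : {poly R[i]}) :
  (forall z, root p z -> 1 < normc z) -> approximable (fun z => p.[z]^-1).
Proof.
move=> pr; have [rs prs] := closed_field_poly_normal p.
have p0 : p != 0.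
  by apply/eqP => pE; have := pr 0; rewrite pE root0 normc0 => /(_ isT); lra.
have rt z : z \in rs -> 1 < normc z.
  by move=> zr; apply: pr; rewrite prs rootZ ?lead_coef_eq0 // root_prod_XsubC.
have -> : (fun z : Cplx R => p.[z]^-1) =
  (fun z => ((lead_coef p)^-1%:P).[z] * (\prod_(r <- rs) (z - r)^-1)).
  apply/funext => z; rewrite hornerC {1}prs hornerZ invfM horner_prod prodfV.
  by under eq_bigr do rewrite hornerXsubC.
apply: approximableM; first exact: approximable_poly.
elim: rs rt {prs} => [_|r rs IH rt].
  have -> : (fun z : Cplx R => \prod_(r <- [::]) (z - r)^-1) = (fun z => 1%:P.[z]).
    by apply/funext => z; rewrite big_nil hornerC.
  exact: approximable_poly.
have -> : (fun z : Cplx R => \prod_(j <- r :: rs) (z - j)^-1) =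
  (fun z => (z - r)^-1 * \prod_(j <- rs) (z - j)^-1).
  by apply/funext => z; rewrite big_cons.
apply: approximableM; first by apply: approximable_linearV; apply: rt; rewrite mem_head.
by apply: IH => z zr; apply: rt; rewrite inE zr orbT.
Qed.

End Approximable.

(** * Uniform limits of polynomials extend holomorphically *)

Section Extension.
Variable R : realType.
Implicit Types (f : Cplx R -> Cplx R).

(** Completeness with an explicit rate: the intervals of radius [b n] around [x n] meet pairwise, so
    the supremum of their left ends lies in all of them. *)
Lemma real_nested (x b : nat -> R) :
  (forall n m, `|x n - x m| <= b n + b m) ->
  exists l, forall n, `|x n - l| <= b n.
Proof.
move=> xb; pose A := [set y | exists n, y = x n - b n].
have ubA m : ubound A (x m + b m).
  by move=> _ [n ->]; have := xb n m; rewrite ler_norml => /andP[]; lra.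
have sA : has_sup A by split; [exists (x 0%N - b 0%N), 0%N|exists (x 0%N + b 0%N)].
exists (sup A) => n; rewrite ler_norml; apply/andP; split.
  by have := ge_sup sA.1 (@ubA n); lra.
have : x n - b n <= sup A by apply: ub_le_sup; [exact: sA.2|exists n].
lra.
Qed.

Lemma complex_nested (u : nat -> R[i]) (b : nat -> R) :
  (forall n m, normc (u n - u m) <= b n + b m) ->
  exists l, forall n, normc (u n - l) <= 2 * b n.
Proof.
move=> ub.
have [|x xP] := @real_nested (fun n => Re (u n)) b.
  by move=> n m; rewrite -raddfB; apply: le_trans (normc_Re _) (ub n m).
have [|y yP] := @real_nested (fun n => Im (u n)) b.
  by move=> n m; rewrite -raddfB; apply: le_trans (normc_Im _) (ub n m).
exists (x +i* y)%C => n; apply: le_trans (normc_ReIm _) _.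
have := xP n; have := yP n; case: (u n) => s t /=; lra.
Qed.

Lemma continuous_poly (p : {poly R[i]}) : continuous (fun z : Cplx R => p.[z] : Cplx R).
Proof.
elim/poly_ind: p => [|p c IH].
  have -> : (fun z : Cplx R => (0 : {poly R[i]}).[z] : Cplx R) = (fun=> 0).
    by apply/funext => w; rewrite horner0.
  exact: cst_continuous.
have -> : (fun z : Cplx R => (p * 'X + c%:P).[z] : Cplx R) =
    (fun z => p.[z] * z + c : Cplx R).
  by apply/funext => w; rewrite !hornerE.
move=> z; have Fz : Filter (nbhs z) by exact: nbhs_filter.
exact: (@cvgD R[i] _ _ _ Fz _ _ _ _ (@cvgM R[i] _ _ Fz _ _ _ _ (IH z) cvg_id) (cvg_cst _)).
Qed.

Lemma ucont_poly (p : {poly R[i]}) : ucont (@closed_disc R) (fun z => p.[z]).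
Proof.
apply: within_ucont; first exact: closed_disc_compact.
apply: continuous_subspaceT; exact: continuous_poly.
Qed.

Lemma le_of_inv_bound (x y k : R) :
  (forall n : nat, x <= y + k * n.+1%:R^-1) -> x <= y.
Proof.
move=> H; rewrite leNgt; apply/negP => yx.
have k0 : 0 < k by have := H 0%N; rewrite invr1; lra.
have xy : 0 < x - y by lra.
have [n] := ltr_add_invr (divr_gt0 xy k0).
rewrite add0r ltr_pdivlMr // => h; have := H n.
by rewrite mulrC -lerBlDl leNgt h.
Qed.

(* The difference quotients at [a] are themselves polynomials, so that the
   maximum principle makes them converge uniformly as well. *)
Lemma approximable_extends f : approximable f -> extends_holomorphically f.
Proof.
move=> fa; pose b (n : nat) : R := n.+1%:R^-1.
have b0 n : 0 < b n by rewrite invr_gt0 ltr0n.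
have [p pP] := choice (fun n => fa (b n) (b0 n)).
have pp n m z : normc z <= 1 -> normc ((p n - p m).[z]) <= b n + b m.
  apply: max_principle => w w1; rewrite hornerD hornerN.
  have wc : circle w by apply/circleE.
  have := normc_triangle (f w) (p n).[w] (p m).[w].
  by have := pP n w wc; have := pP m w wc; rewrite (normcB (p n).[w] (f w)); lra.
(* Outside the closed disc the condition on [l] is vacuous, and the extension takes arbitrary
   values. *)
have FE z : exists l, normc z <= 1 -> forall n, normc ((p n).[z] - l) <= 2 * b n.
  have [z1|_] := leP (normc z) 1; last by exists 0.
  have [|l lP] := @complex_nested (fun n => (p n).[z]) b; last by exists l.
  by move=> n m; have := pp n m z z1; rewrite hornerD hornerN.
have [F FP] := choice FE.
have small e : 0 < e -> exists n, b n < e.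
  by move=> e0; have [n] := ltr_add_invr e0; rewrite add0r; exists n.
exists F; split.
- apply: ucont_within => e e0.
  have [n ne] : exists n, b n < e / 5 by apply: small; lra.
  have [d d0 pd] := @ucont_poly (p n) (e / 5) ltac:(lra).
  exists d => // z w zc wc zw; have := pd z w zc wc zw.
  move/closed_discE: zc => /FP/(_ n) h1; move/closed_discE: wc => /FP/(_ n) h2 h3.
  have := normc_triangle (p n).[z] (F z) (F w).
  have := normc_triangle (p n).[w] (p n).[z] (F w).
  by rewrite (normcB (F z) (p n).[z]); lra.
- move=> a /discE a1; apply/derivable_normcP.
  have d0 : 0 < 1 - normc a by lra.
  (* On the circle the denominator [z - a] of a difference quotient has modulus at least [1 - |a|];
     the 2 accounts for the values at [z] and at [a]. *)
  pose c := 2 / (1 - normc a).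
  have c0 : 0 < c by rewrite divr_gt0.
  have [q qP] : exists q : nat -> {poly R[i]},
      forall n, p n - (p n).[a]%:P = q n * ('X - a%:P).
    have /choice[q qP] : forall n, exists q, p n - (p n).[a]%:P = q * ('X - a%:P).
      move=> n; apply/factor_theorem; rewrite rootE !hornerE subrr //.
    by exists q.
  have qE n w : (q n).[w] * (w - a) = (p n).[w] - (p n).[a].
    by have := congr1 (fun r => r.[w]) (qP n); rewrite !hornerE.
  have qq n m w : normc w <= 1 -> normc ((q n - q m).[w]) <= c * b n + c * b m.
    apply: max_principle => z z1; rewrite -mulrDr /c mulrAC ler_pdivlMr //.
    apply: (@le_trans _ _ (normc ((q n - q m).[z]) * normc (z - a))).
      rewrite ler_wpM2l ?normc_ge0 //.
      by have := normc_triangle a z 0; rewrite !subr0 z1; lra.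
    rewrite -normcM hornerD hornerN mulrBl !qE.
    have zle : normc z <= 1 by rewrite z1.
    have := pp n m z zle; have := pp n m a (ltW a1).
    have := normc_triangle 0 ((p n).[z] - (p m).[z]) ((p n).[a] - (p m).[a]).
    rewrite subr0 sub0r normcN !hornerD !hornerN.
    have -> : (p n).[z] - (p m).[z] - ((p n).[a] - (p m).[a]) =
      (p n).[z] - (p n).[a] - ((p m).[z] - (p m).[a]) by ring.
    lra.
  have [|l lP] := @complex_nested (fun n => (q n).[a]) (fun n => c * b n).
    by move=> n m; have := qq n m a (ltW a1); rewrite hornerD hornerN.
  exists l => e e0.
  have [n ne] : exists n, b n < e / (4 * c) by apply: small; rewrite divr_gt0 // mulr_gt0.
  have cn : 4 * c * b n < e by rewrite mulrC -ltr_pdivlMr // mulr_gt0.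
  (* The part [3 * c * b n] is reserved: [c * b n] for replacing [q m] by [q n] at [w], and
     [2 * (c * b n)] for replacing [(q n).[a]] by [l]. *)
  have [d dp qd] := @ucont_poly (q n) ((e - 3 * c * b n)) ltac:(have := mulr_gt0 c0 (b0 n); lra).
  exists (Num.min d (1 - normc a)); first by rewrite lt_min dp d0.
  move=> w; rewrite lt_min => /andP[wd wa].
  have w1 : normc w <= 1.
    by have := normc_triangle a w 0; rewrite !subr0; lra.
  have wq := qd w a (iffRL (closed_discE _) w1) (iffRL (closed_discE _) (ltW a1)) wd.
  (* The auxiliary index [m] goes to infinity with [n] and [w] fixed: it replaces the values of [F]
     by those of [p m], which factor through [q m]. *)
  apply: (@le_of_inv_bound _ _ (4 + c * normc (w - a))) => m; rewrite -/(b m).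
  have -> : F w - F a - l * (w - a) =
    (- ((p m).[w] - F w) + ((p m).[a] - F a)) +
    ((q m - q n).[w] + ((q n).[w] - (q n).[a]) + ((q n).[a] - l)) * (w - a).
    rewrite !mulrDl hornerD hornerN mulrBl !qE; ring.
  apply: le_trans (le_normcD _ _) _; rewrite normcM.
  have h1 : normc (- ((p m).[w] - F w) + ((p m).[a] - F a)) <= 4 * b m.
    apply: le_trans (le_normcD _ _) _; rewrite normcN.
    by have := FP w w1 m; have := FP a (ltW a1) m; lra.
  have h2 : normc ((q m - q n).[w] + ((q n).[w] - (q n).[a]) + ((q n).[a] - l)) <=
      c * b m + e.
    apply: le_trans (le_normcD _ _) _.
    have := le_normcD (q m - q n).[w] ((q n).[w] - (q n).[a]).
    have := lP n; have := qq m n w w1; lra.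
  have := ler_wpM2r (normc_ge0 (w - a)) h2; lra.
- move=> z zc; apply/eqP; rewrite -subr_eq0 -normc_eq0 eq_le normc_ge0 andbT.
  have /FP z1 : normc z <= 1 by move/circleE: zc => ->.
  apply: (@le_of_inv_bound _ _ 3) => n; rewrite -/(b n) add0r.
  have := normc_triangle (p n).[z] (F z) (f z); 
  rewrite (normcB (F z) (p n).[z]) (normcB (p n).[z] (f z)).
  by have := z1 n; have := pP n z zc; lra.
Qed.

End Extension.

(** * Discrete Fejer means *)

Section Fejer.
Variable R : realType.
Implicit Types (f : Cplx R -> Cplx R).

Lemma ucont_bounded A f : compact A -> ucont A f ->
  exists2 B : R, 0 < B & forall z, A z -> normc (f z) <= B.
Proof.
rewrite compact_near_coveringP => cA fu.
have [d d0 fd] := fu 1 ltr01.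
have : \forall B \near +oo%R, A `<=` (fun z => A z -> normc (f z) <= B).
  apply: cA => z Az.
  exists ([set z' | normc (z' - z) < d], [set B : R | normc (f z) + 1 < B]).
    split; first by apply/nbhs_normcP; exists d.
    by exists (normc (f z) + 1); split; rewrite ?num_real.
  move=> [z' B] /= [z'z zB] Az'.
  have := fd z' z Az' Az z'z; have := normc_triangle (f z) (f z') 0.
  by rewrite !subr0; lra.
move=> [B [_ BP]]; exists (`|B| + 1); first by have := normr_ge0 B; lra.
move=> z Az; apply: (BP (`|B| + 1) _ z Az Az).
by have := ler_norm B; rewrite /=; lra.
Qed.

Lemma geometric_sum_bound (w : R[i]) N : normc w = 1 ->
  normc (\sum_(j < N) w ^+ j) * normc (w - 1) <= 2.
Proof.
move=> w1; rewrite mulrC -normcM -subrX1; apply: le_trans (le_normcD _ _) _.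
by rewrite normcN normcX w1 expr1n normc1.
Qed.

(** The total mass of the Fejer kernel, by Parseval for the polynomial with [N] coefficients equal
    to 1. *)
Lemma fejer_weight M N (c : R[i]) : normc c = 1 -> (N <= M)%N ->
  \sum_(k < M) normc (\sum_(j < N) (c * unity_root R M ^+ k) ^+ j) ^+ 2 =
  M%:R * N%:R.
Proof.
move=> c1 NM; pose p : {poly R[i]} := \poly_(j < N) 1.
have pN : (size p <= N)%N by exact: size_poly.
have := parseval c1 (leq_trans pN NM).
have -> : \sum_(i < M) normc p`_i ^+ 2 = N%:R.
  rewrite -(big_mkord xpredT (fun i => normc p`_i ^+ 2)) (big_cat_nat (n := N)) //=.
  rewrite [X in _ + X](_ : _ = 0) ?addr0; last first.
    rewrite big_nat_cond big1 // => i /andP[/andP[Ni _] _].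
    by rewrite coef_poly ltnNge Ni [normc _]normc0 expr0n.
  rewrite big_mkord (eq_bigr (fun=> 1)) ?sumr_const ?card_ord // => i _.
  by rewrite coef_poly ltn_ord normc1 expr1n.
move=> <-; apply: eq_bigr => k _; congr (normc _ ^+ 2).
by rewrite (horner_coef_wide _ pN); apply: eq_bigr => j _; rewrite coef_poly ltn_ord mul1r.
Qed.

(** [M] times the discrete Fourier coefficient of [f] at frequency [j - i]; two indices avoid
    negative exponents. *)
Definition sampled_moment f M i j : R[i] :=
  \sum_(k < M) f (unity_root R M ^+ k) *
    ((unity_root R M ^+ k) ^+ i * ((unity_root R M ^+ k) ^+ j)^*%C).

(** This form shows a Laurent polynomial on the circle; [fejer_meanE] rewrites it as an average with
    nonnegative weights, from which convergence follows. *)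
Definition fejer_mean f M N (z : R[i]) : R[i] :=
  (M%:R * N%:R)^-1 *
  \sum_(i < N) \sum_(j < N) sampled_moment f M i j * (z ^+ j * (z ^+ i)^*%C).

Lemma fejer_meanE f M N z : fejer_mean f M N z =
  (M%:R * N%:R)^-1 * \sum_(k < M) f (unity_root R M ^+ k) *
    (normc (\sum_(j < N) (z^*%C * unity_root R M ^+ k) ^+ j) ^+ 2)%:C%C.
Proof.
rewrite /fejer_mean; congr (_ * _).
pose a k : R[i] := z^*%C * unity_root R M ^+ k.
have E (k : 'I_M) : f (unity_root R M ^+ k) *
    (normc (\sum_(j < N) a k ^+ j) ^+ 2)%:C%C =
    \sum_(i < N) \sum_(j < N) f (unity_root R M ^+ k) * (a k ^+ i * (a k ^+ j)^*%C).
  rewrite -mul_conjc rmorph_sum /= mulr_suml mulr_sumr.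
  by apply: eq_bigr => i _; rewrite !mulr_sumr.
rewrite (eq_bigr _ (fun k _ => E k)) [RHS]exchange_big /=; apply: eq_bigr => i _.
rewrite [RHS]exchange_big /=; apply: eq_bigr => j _.
rewrite mulr_suml; apply: eq_bigr => k _; rewrite /a.
by rewrite !exprMn !rmorphM /= !rmorphXn /= conjcK; ring.
Qed.

(* The nodes are the [M]-th roots of unity; the error bound depends on the
   degree [N] only, not on the number [M >= N] of nodes. *)
Lemma fejer f (e : R) : ucont (@circle R) f -> 0 < e ->
  exists2 N, (0 < N)%N & forall M, (N <= M)%N -> forall z, circle z ->
    normc (f z - fejer_mean f M N z) < e.
Proof.
move=> fu e0; have [B B0 fB] := ucont_bounded (@circle_compact R) fu.
have e2 : 0 < e / 2 by lra.
have [d d0 fd] := fu _ e2.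
(* Nodes at distance at least [d] from [z] have weight at most [4 / d ^+ 2] and contribute a
   difference at most [2 * B]. Divided by the total mass, all of them together stay below
   [C / N]. *)
pose C := 8 * B / d ^+ 2.
have C0 : 0 < C by rewrite /C divr_gt0 ?exprn_gt0 // mulr_gt0.
have [n] := ltr_add_invr (divr_gt0 e2 C0); rewrite add0r => ne.
exists n.+1 => // M NM z zc; rewrite fejer_meanE.
set N := n.+1; move/circleE: (zc) => z1.
have M0 : (0 < M)%N by apply: leq_trans NM.
have MN0 : 0 < M%:R * N%:R :> R by rewrite mulr_gt0 ?ltr0n.
have MN0' : M%:R * N%:R != 0 :> R[i] by rewrite mulf_neq0 // pnatr_eq0 // -lt0n.
pose x k : R[i] := unity_root R M ^+ k.
have x1 k : normc (x k) = 1 by rewrite normcX normc_unity_root expr1n.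
pose W k := normc (\sum_(j < N) (z^*%C * x k) ^+ j) ^+ 2.
have W0 k : 0 <= W k by rewrite exprn_ge0 ?normc_ge0.
have zz1 : normc z^*%C = 1 by rewrite normc_conj.
have WS : \sum_(k < M) W k = M%:R * N%:R by rewrite /W fejer_weight.
have -> : f z - (M%:R * N%:R)^-1 * \sum_(k < M) f (x k) * (W k)%:C%C =
  (M%:R * N%:R)^-1 * \sum_(k < M) (f z - f (x k)) * (W k)%:C%C.
  under [in RHS]eq_bigr do rewrite mulrBl.
  rewrite sumrB -mulr_sumr -rmorph_sum WS rmorphM !rmorph_nat /= mulrBr.
  by congr (_ - _); rewrite mulrCA mulVf // mulr1.
rewrite normcM normcV normcM !normc_nat mulrC ltr_pdivrMr //.
apply: le_lt_trans (normc_sum _ _ _) _.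
have tb (k : 'I_M) : normc ((f z - f (x k)) * (W k)%:C%C) <= e / 2 * W k + C.
  rewrite normcM normc_real (ger0_norm (W0 _)).
  have xc : circle (x k) by apply/circleE.
  have [zx|zx] := ltP (normc (z - x k)) d.
    have := ler_wpM2r (W0 k) (ltW (fd z (x k) zc xc zx)); lra.
  have fbd : normc (f z - f (x k)) <= 2 * B.
    have := normc_triangle 0 (f z) (f (x k)); rewrite subr0 sub0r normcN.
    by have := fB z zc; have := fB (x k) xc; lra.
  have w1 : normc (z^*%C * x k) = 1 by rewrite normcM zz1 x1 mulr1.
  have := geometric_sum_bound N w1.
  have -> : normc (z^*%C * x k - 1) = normc (z - x k).
    rewrite -[RHS]mul1r -zz1 -normcM mulrBr [z^*%C * z]mulrC mul_conjc z1 expr1n.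
    exact: normcB.
  move=> D2; have Wd : W k * d ^+ 2 <= 4.
    have -> : 4 = 2 ^+ 2 :> R by ring.
    rewrite -exprMn lerXn2r ?nnegrE ?mulr_ge0 ?normc_ge0 ?(ltW d0) //.
    by apply: le_trans D2; rewrite ler_wpM2l ?normc_ge0.
  have h : normc (f z - f (x k)) * W k <= C.
    rewrite /C ler_pdivlMr ?exprn_gt0 // -mulrA.
    have d2 : 0 <= W k * d ^+ 2 by apply: mulr_ge0 => //; rewrite exprn_ge0 ?(ltW d0).
    apply: le_trans (ler_wpM2r d2 fbd) _.
    have := ler_wpM2l (ltW B0) Wd; lra.
  have := mulr_ge0 (ltW e2) (W0 k); lra.
apply: le_lt_trans (ler_sum _ (fun k _ => tb k)) _.
rewrite big_split /= -mulr_sumr WS sumr_const card_ord -mulr_natl.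
have Nn : C < e / 2 * N%:R.
  by move: ne; rewrite ltr_pdivlMr // mulrC ltr_pdivrMr ?ltr0n.
have := ltr_pM2l (x := M%:R : R); rewrite ltr0n => /(_ M0 C (e / 2 * N%:R)).
rewrite Nn => h; lra.
Qed.

Lemma fejer_laurent f (e : R) : ucont (@circle R) f -> 0 < e ->
  exists N, exists2 s : {poly R[i]}, (0 < N)%N & forall z, circle z ->
    normc (f z - s.[z] / z ^+ N) < e.
Proof.
move=> fu e0; have [N N0 /(_ N (leqnn N)) fN] := fejer fu e0.
(* As many nodes as the degree are enough here. Multiplication by [z ^+ N] clears the negative
   powers: [N + j - i] is a true difference because [i < N]. *)
exists N, ((N%:R * N%:R)^-1 *:
  \sum_(i < N) \sum_(j < N) sampled_moment f N i j *: 'X^(N + j - i)) => // z zc.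
have -> : (((N%:R * N%:R)^-1 *: \sum_(i < N) \sum_(j < N)
  sampled_moment f N i j *: 'X^(N + j - i)).[z]) / z ^+ N = fejer_mean f N N z.
  move/circleE: zc => z1.
  have z0 : z != 0 by rewrite -normc_gt0 z1.
  rewrite hornerZ -mulrA; congr (_ * _).
  rewrite horner_sum mulr_suml; apply: eq_bigr => i _.
  rewrite horner_sum mulr_suml; apply: eq_bigr => j _.
  rewrite hornerZ hornerXn -mulrA; congr (_ * _).
  rewrite conjc_circle ?normcX ?z1 ?expr1n //.
  apply: (mulIf (expf_neq0 N z0)); rewrite divfK ?expf_neq0 //.
  apply: (mulIf (expf_neq0 i z0)); rewrite -exprD subnK; last first.
    by rewrite (leq_trans (ltnW (ltn_ord i))) // leq_addr.
  by rewrite mulrAC divfK ?expf_neq0 // exprD mulrC.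
exact: fN.
Qed.

Lemma approximable_moments f : ucont (@circle R) f ->
  (forall n (e : R), (0 < n)%N -> 0 < e -> exists m0, forall m, (m0 <= m)%N ->
    normc (\sum_(k < 2 ^ m) f (unity_root R (2 ^ m) ^+ k) *
      (unity_root R (2 ^ m) ^+ k) ^+ n) < e * (2 ^ m)%:R) ->
  approximable f.
Proof.
move=> fu mom e e0; have e2 : 0 < e / 2 by lra.
have [N N0 fN] := fejer fu e2.
(* At most [N * N] moments are dropped, and the mean is divided by [M * N]. *)
have e2N : 0 < e / 2 / N%:R by rewrite divr_gt0 ?ltr0n.
have [m0 m0P] := choice (fun n => mom n.+1 _ (ltn0Sn n) e2N).
(* [m0 n] belongs to the exponent [n.+1], so the dropped frequency [i - j] is looked up at
   [i - j.+1]. *)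
pose m := maxn N (\max_(n < N) m0 n).
have Nm : (N <= 2 ^ m)%N.
  by apply: leq_trans (ltnW (ltn_expl m (ltnSn 1))); rewrite leq_maxl.
set M := (2 ^ m)%N in Nm *.
have M0 : (0 < M)%N by apply: leq_trans Nm.
have smallm (i j : 'I_N) : (j < i)%N ->
    normc (sampled_moment f M i j) <= e / 2 / N%:R * M%:R.
  move=> ji; have ijN : (i - j.+1 < N)%N by rewrite (leq_ltn_trans (leq_subr _ _)).
  have mm : (m0 (i - j.+1)%N <= m)%N.
    by rewrite leq_max (leq_bigmax (F := fun n : 'I_N => m0 n) (Ordinal ijN)) orbT.
  apply: ltW; apply: le_lt_trans (m0P (i - j.+1)%N m mm).
  rewrite le_eqVlt; apply/orP; left; apply/eqP; congr normc.
  apply: eq_bigr => k _; congr (_ * _).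
  rewrite conjc_circle ?normcX ?normc_unity_root ?expr1n //.
  by rewrite subnSK // -{1}(subnK (ltnW ji)) exprD mulfK // !expf_neq0 // unity_root_neq0.
exists ((M%:R * N%:R)^-1 *: \sum_(i < N) \sum_(j < N | (i <= j)%N)
  sampled_moment f M i j *: 'X^(j - i)) => z zc.
have := fN M Nm z zc; set q := (_ *: _).
have MN0 : 0 < M%:R * N%:R :> R by rewrite mulr_gt0 ?ltr0n.
suff : normc (fejer_mean f M N z - q.[z]) <= e / 2.
  by have := normc_triangle (fejer_mean f M N z) (f z) q.[z]; lra.
move/circleE: zc => z1; have z0 : z != 0 by rewrite -normc_gt0 z1.
have -> : fejer_mean f M N z - q.[z] = (M%:R * N%:R)^-1 *
  \sum_(i < N) \sum_(j < N | ~~ (i <= j)%N) sampled_moment f M i j * (z ^+ j * (z ^+ i)^*%C).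
  rewrite /fejer_mean /q hornerZ -mulrBr; congr (_ * _).
  rewrite horner_sum -sumrB; apply: eq_bigr => i _.
  rewrite (bigID (fun j : 'I_N => (i <= j)%N)) /= horner_sum.
  set S1 := (X in X + _ - _); set S2 := (X in _ + X - _); set S3 := (X in _ - X).
  suff -> : S1 = S3 by rewrite addrAC subrr add0r.
  apply: eq_bigr => j ij; rewrite hornerZ hornerXn; congr (_ * _).
  rewrite conjc_circle ?normcX ?z1 ?expr1n //.
  by rewrite -{1}(subnK ij) exprD mulfK // expf_neq0.
rewrite normcM normcV normcM !normc_nat mulrC ler_pdivrMr //.
apply: le_trans (normc_sum _ _ _) _.
apply: (@le_trans _ _ (\sum_(i < N) \sum_(j < N) e / 2 / N%:R * M%:R)).
  apply: ler_sum => i _; apply: le_trans (normc_sum _ _ _) _.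
  rewrite [leRHS](bigID (fun j : 'I_N => (i <= j)%N)) /= ler_wpDl //.
    by apply: sumr_ge0 => j _; rewrite mulr_ge0 // ltW.
  apply: ler_sum => j; rewrite -ltnNge => ji.
  by rewrite !normcM normc_conj !normcX z1 !expr1n !mulr1 smallm.
rewrite !sumr_const !card_ord.
have -> (K : R) : K *+ N *+ N = N%:R * N%:R * K.
  by rewrite -mulrnA -natrM mulr_natl.
have N0' : N%:R != 0 :> R by rewrite pnatr_eq0 -lt0n.
by rewrite le_eqVlt; apply/orP; left; apply/eqP; field.
Qed.

End Fejer.

(** * Cauchy's theorem for Riemann sums *)

Section Goursat.
Variable R : realType.
Implicit Types (G : R[i] -> R[i]).

Lemma expi_lipschitz (s t : R) : normc (expi s - expi t) <= 2 * `|s - t|.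
Proof.
wlog st : s t / t < s => [H|].
  have [ts|st|->] := ltgtP s t; last by rewrite !subrr normr0 mulr0 normc0.
    by rewrite normcB distrC; exact: H.
  exact: H.
have [x _ cE] := MVT st (fun x _ => is_derive_cos x)
  (continuous_subspaceT (@continuous_cos R)).
have [y _ sE] := MVT st (fun x _ => is_derive_sin x)
  (continuous_subspaceT (@continuous_sin R)).
apply: le_trans (normc_ReIm _) _; rewrite /= cE sE !normrM normrN.
have := cos_max y; have := sin_max x; have := normr_ge0 (s - t).
set u := `|sin x|; set v := `|cos y|; set w := `|s - t| => w0 u1 v1.
have := ler_wpM2r w0 u1; have := ler_wpM2r w0 v1; lra.
Qed.

(** Polar coordinates turn the disc into a dyadic square whose boundary sum lives on the roots of
    unity: the two radial sides coincide, and the side of radius 0 degenerates to a point. *)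
Definition polar_grid m j k : R[i] :=
  (j%:R / (2 ^ m)%:R) * unity_root R (2 ^ m) ^+ k.

(* Twice the trapezoidal rule for the integral of [G] along a segment: it is
   exact on affine functions. *)
Definition trapezoid G (z w : R[i]) := (G z + G w) * (w - z).

Definition radial_edge G m j k :=
  trapezoid G (polar_grid m j k) (polar_grid m j.+1 k).

Definition angular_edge G m j k :=
  trapezoid G (polar_grid m j k) (polar_grid m j k.+1).

Definition cell G m j k :=
  radial_edge G m j k + angular_edge G m j.+1 k
  - radial_edge G m j k.+1 - angular_edge G m j k.

Definition block G m J K s := \sum_(j < s) \sum_(k < s) cell G m (J + j) (K + k).

Lemma blockD G m J K s : block G m J K (s + s) =
  block G m J K s + block G m J (K + s) s +
  (block G m (J + s) K s + block G m (J + s) (K + s) s).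
Proof.
rewrite /block big_split_ord /=; congr (_ + _); rewrite -big_split /=;
  apply: eq_bigr => j _; rewrite big_split_ord /=; congr (_ + _);
  by apply: eq_bigr => k _; rewrite ?addnA.
Qed.

Lemma cell_affine G m j k (u v : R[i]) :
  cell (fun z => G z - (u + v * z)) m j k = cell G m j k.
Proof. by rewrite /cell /radial_edge /angular_edge /trapezoid; ring. Qed.

Lemma sum_telescope (u : nat -> R[i]) J s :
  \sum_(j < s) (u (J + j).+1 - u (J + j)%N) = u (J + s)%N - u J.
Proof.
elim: s => [|s IH]; first by rewrite big_ord0 addn0 subrr.
by rewrite big_ord_recr /= IH addnS; ring.
Qed.

(** Neighbouring cells traverse their common edge in opposite directions, so interior edges
    telescope away in both directions. *)
Lemma block_boundary G m J K s : block G m J K s =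
  \sum_(k < s) (angular_edge G m (J + s) (K + k) - angular_edge G m J (K + k)) +
  \sum_(j < s) (radial_edge G m (J + j) K - radial_edge G m (J + j) (K + s)).
Proof.
have E (j k : nat) : cell G m (J + j) (K + k) =
   (angular_edge G m (J + j).+1 (K + k) - angular_edge G m (J + j) (K + k))
   - (radial_edge G m (J + j) (K + k).+1 - radial_edge G m (J + j) (K + k)).
  by rewrite /cell; ring.
rewrite /block; under eq_bigr => j _.
  under eq_bigr do rewrite E.
  rewrite sumrB (sum_telescope (fun k => radial_edge G m (J + j) k)).
  over.
rewrite sumrB exchange_big /= -sumrN; congr (_ + _); apply: eq_bigr => i _.
  exact: (sum_telescope (fun j => angular_edge G m j (K + i))).
by rewrite opprB.
Qed.

Lemma trapezoid_bound G z w (b d : R) : normc (G z) <= b -> normc (G w) <= b ->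
  normc (w - z) <= d -> normc (trapezoid G z w) <= 2 * b * d.
Proof.
move=> zb wb wz; rewrite normcM.
have b0 : 0 <= b by apply: le_trans zb; exact: normc_ge0.
apply: ler_pM => //; try exact: normc_ge0.
by apply: le_trans (le_normcD _ _) _; lra.
Qed.

Lemma unity_root_step m : normc (unity_root R m - 1) <= 4 * pi / m%:R.
Proof.
rewrite -(@expi0 R); apply: le_trans (expi_lipschitz _ _) _; rewrite subr0.
rewrite ger0_norm; last by rewrite divr_ge0 // mulr_ge0 ?pi_ge0.
by rewrite le_eqVlt; apply/orP; left; apply/eqP; ring.
Qed.

(** Perimeter times maximum: four sides of [s] edges, of length [1 / 2^m] at most for radial ones
    and [4 * pi / 2^m] for angular ones, the Lipschitz constant 2 of [expi] being crude. *)
Lemma block_bound G m J K s (b : R) : (J + s <= 2 ^ m)%N ->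
  (forall j k, (j <= s)%N -> (k <= s)%N ->
     normc (G (polar_grid m (J + j) (K + k))) <= b) ->
  normc (block G m J K s) <= s%:R * (4 * b * (1 + 4 * pi) / (2 ^ m)%:R).
Proof.
move=> Js Gb; pose h : R := ((2 ^ m)%:R)^-1.
have M0 : 0 < (2 ^ m)%:R :> R by rewrite ltr0n expn_gt0.
have M0' : (2 ^ m)%:R != 0 :> R[i] by rewrite pnatr_eq0 -lt0n expn_gt0.
have h0 : 0 < h by rewrite invr_gt0.
have nMV : normc ((2 ^ m)%:R^-1 : R[i]) = h by rewrite normcV normc_nat.
have rlen j k : normc (polar_grid m j.+1 k - polar_grid m j k) <= h.
  rewrite /polar_grid -mulrBl -mulrBl -natrB // subSnn mul1r normcM nMV.
  by rewrite normcX normc_unity_root expr1n mulr1.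
have alen j k : (j <= 2 ^ m)%N ->
    normc (polar_grid m j k.+1 - polar_grid m j k) <= 4 * pi * h.
  move=> jm; rewrite /polar_grid -mulrBr exprSr -{2}[_ ^+ k]mulr1 -mulrBr.
  rewrite !normcM normcX normc_unity_root expr1n mul1r nMV normc_nat.
  apply: le_trans (unity_root_step _); rewrite -[leRHS]mul1r.
  rewrite ler_wpM2r ?normc_ge0 // ler_pdivrMr // mul1r ler_nat //.
have rb j k : (j < s)%N -> (k <= s)%N ->
    normc (radial_edge G m (J + j) (K + k)) <= 2 * b * h.
  move=> js ks; apply: trapezoid_bound; [exact: Gb (ltnW js) ks| |exact: rlen].
  by rewrite -addnS; exact: Gb.
have ab j k : (j <= s)%N -> (k < s)%N ->
    normc (angular_edge G m (J + j) (K + k)) <= 2 * b * (4 * pi * h).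
  move=> js ks; apply: trapezoid_bound; [exact: Gb js (ltnW ks)| |].
    by rewrite -addnS; exact: Gb.
  by apply: alen; apply: leq_trans Js; rewrite leq_add2l.
rewrite block_boundary; apply: le_trans (le_normcD _ _) _.
have S1 : normc (\sum_(k < s) (angular_edge G m (J + s) (K + k) -
    angular_edge G m J (K + k))) <= \sum_(k < s) (4 * b * (4 * pi * h)).
  apply: le_trans (normc_sum _ _ _) _; apply: ler_sum => k _.
  apply: le_trans (le_normcD _ _) _; rewrite normcN.
  have := ab s k (leqnn _) (ltn_ord k); have := ab 0%N k (leq0n _) (ltn_ord k).
  by rewrite addn0; lra.
have S2 : normc (\sum_(j < s) (radial_edge G m (J + j) K -
    radial_edge G m (J + j) (K + s))) <= \sum_(k < s) (4 * b * h).
  apply: le_trans (normc_sum _ _ _) _; apply: ler_sum => j _.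
  apply: le_trans (le_normcD _ _) _; rewrite normcN.
  have := rb j s (ltn_ord j) (leqnn _); have := rb j 0%N (ltn_ord j) (leq0n _).
  by rewrite addn0; lra.
move: S1 S2; rewrite !sumr_const card_ord => S1 S2.
apply: le_trans (lerD S1 S2) _; rewrite -mulrnDl -(mulr_natl (_ + _)).
by rewrite le_eqVlt; apply/orP; left; apply/eqP; rewrite -/h; ring.
Qed.

(* A dyadic block is identified by its level [l] and its position; the size
   [2 ^ n] of the block counts the cells of a finer and finer grid. *)
Definition large_block G l p q (c : R) := forall n0, exists2 n, (n0 <= n)%N &
  c <= normc (block G (l + n) (p * 2 ^ n) (q * 2 ^ n) (2 ^ n)).

(** Were the four children small on all fine enough grids, so would be their parent, since
    [2 ^ n.+1] cells along its side are [2 ^ n] along the side of each child. *)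
Lemma large_block_child G l p q c : large_block G l p q c ->
  exists i j, [/\ (i < 2)%N, (j < 2)%N & large_block G l.+1 (p * 2 + i) (q * 2 + j) (c / 4)].
Proof.
move=> bd; apply: contrapT => nb.
have good i j : (i < 2)%N -> (j < 2)%N -> exists n0, forall n, (n0 <= n)%N ->
    normc (block G (l.+1 + n) ((p * 2 + i) * 2 ^ n) ((q * 2 + j) * 2 ^ n) (2 ^ n)) < c / 4.
  move=> i2 j2; apply: contrapT => H; apply: nb; exists i, j; split=> // n0.
  apply: contrapT => H'; apply: H; exists n0 => n n0n; rewrite ltNge.
  by apply/negP => cn; apply: H'; exists n.
have [n1 h1] := good 0%N 0%N isT isT; have [n2 h2] := good 0%N 1%N isT isT.
have [n3 h3] := good 1%N 0%N isT isT; have [n4 h4] := good 1%N 1%N isT isT.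
have [[//|n] nN] := bd (n1 + n2 + n3 + n4).+1.
have {h1} := h1 n ltac:(lia); have {h2} := h2 n ltac:(lia).
have {h3} := h3 n ltac:(lia); have {h4} := h4 n ltac:(lia).
rewrite !addn0 !mulnDl mul1n -!mulnA -!expnS addSnnS.
move=> h4 h3 h2 h1; rewrite leNgt => /negP; apply.
rewrite [X in block _ _ _ _ X]expnS mul2n -addnn blockD.
apply: le_lt_trans (le_normcD _ _) _.
apply: le_lt_trans (lerD (le_normcD _ _) (le_normcD _ _)) _.
lra.
Qed.

Lemma dyadic_nested (p : nat -> nat) :
  (forall l, (p l * 2 <= p l.+1 <= p l * 2 + 1)%N) ->
  exists r : R, forall l, `|(p l)%:R / (2 ^ l)%:R - r| <= ((2 ^ l)%:R)^-1.
Proof.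
move=> pS; pose x l : R := (p l)%:R / (2 ^ l)%:R; pose b l : R := ((2 ^ l)%:R)^-1.
have bS l : b l.+1 = b l / 2 by rewrite /b expnS natrM invfM mulrC.
have b0 l : 0 < b l by rewrite invr_gt0 ltr0n expn_gt0.
have xS l : x l <= x l.+1 <= x l + b l.+1.
  have [p1 p2] := andP (pS l).
  have -> : x l = (p l * 2)%:R * b l.+1.
    by rewrite /x -/(b l) bS natrM; field.
  rewrite /x -/(b _) -[X in _ + X]mul1r -mulrDl !ler_pM2r //.
  by rewrite natr1 !ler_nat p1 /= -[(p l * 2).+1]addn1.
have xD n k : x n <= x (n + k)%N <= x n + b n - b (n + k)%N.
  elim: k => [|k /andP[h1 h2]]; first by rewrite addn0; apply/andP; split; lra.
  rewrite addnS; have /andP[h3 h4] := xS (n + k)%N; have := bS (n + k)%N.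
  by move=> h5; apply/andP; split; lra.
apply: (@real_nested _ x b) => n m.
have [nm|mn] := leqP n m.
  have := xD n (m - n)%N; rewrite subnKC // => /andP[h1 h2].
  by have := b0 n; have := b0 m; rewrite ler_norml => h3 h4; apply/andP; split; lra.
have := xD m (n - m)%N; rewrite subnKC ?(ltnW mn) // => /andP[h1 h2].
by have := b0 n; have := b0 m; rewrite ler_norml => h3 h4; apply/andP; split; lra.
Qed.

Lemma large_block_nested G c : large_block G 0 0 0 c ->
  exists p q : nat -> nat, forall l,
    [/\ (p l * 2 <= p l.+1 <= p l * 2 + 1)%N, (q l * 2 <= q l.+1 <= q l * 2 + 1)%N,
        (p l < 2 ^ l)%N, p 0%N = 0%N & large_block G l (p l) (q l) (c / (4 ^ l)%:R)].
Proof.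
move=> bd0.
(* [choice] wants a total function; nothing is asked of [next] off the large blocks. *)
have /choice[next nP] : forall x : nat * (nat * nat), exists y : nat * nat,
    large_block G x.1 x.2.1 x.2.2 (c / (4 ^ x.1)%:R) ->
    [/\ (x.2.1 * 2 <= y.1 <= x.2.1 * 2 + 1)%N,
        (x.2.2 * 2 <= y.2 <= x.2.2 * 2 + 1)%N &
        large_block G x.1.+1 y.1 y.2 (c / (4 ^ x.1.+1)%:R)].
  move=> [l [p q]] /=; have [b|nb] := pselect (large_block G l p q (c / (4 ^ l)%:R)); last by exists (0%N, 0%N).
  have [i [j [i2 j2 b']]] := large_block_child b; exists (p * 2 + i, q * 2 + j)%N => _ /=.
  split; [lia|lia|].
  have -> : c / (4 ^ l.+1)%:R = c / (4 ^ l)%:R / 4 :> R by rewrite expnSr natrM invfM mulrA.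
  exact: b'.
pose fix u l : nat * nat := if l is l'.+1 then next (l', u l') else (0%N, 0%N).
have uP l : large_block G l (u l).1 (u l).2 (c / (4 ^ l)%:R).
  elim: l => [|l IH]; first by rewrite /= expn0 divr1.
  by have [_ _] := nP (l, u l) IH.
have uS l := nP (l, u l) (uP l).
exists (fun l => (u l).1), (fun l => (u l).2) => l.
have [h1 h2 _] := uS l; split=> //.
elim: l {h1 h2} => [//|l IH]; have [h1 _ _] := uS l.
by move: h1 IH; rewrite expnSr /=; lia.
Qed.

Lemma polar_grid_dist m j k (r t : R) : (j <= 2 ^ m)%N ->
  normc (polar_grid m j k - r%:C%C * expi t) <=
  `|j%:R / (2 ^ m)%:R - r| + 2 * `|k%:R * (2 * pi / (2 ^ m)%:R) - t|.
Proof.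
move=> jm; rewrite /polar_grid /unity_root -expiM.
set x : R := j%:R / (2 ^ m)%:R; set s : R := k%:R * _.
have -> : j%:R / (2 ^ m)%:R = x%:C%C :> R[i].
  by rewrite /x rmorphM fmorphV !rmorph_nat.
have -> : x%:C%C * expi s - r%:C%C * expi t =
  x%:C%C * (expi s - expi t) + (x - r)%:C%C * expi t by rewrite rmorphB /=; ring.
apply: le_trans (le_normcD _ _) _; rewrite addrC !normcM !normc_real normc_expi mulr1.
rewrite lerD2l; apply: le_trans (expi_lipschitz _ _); rewrite -[leRHS]mul1r.
rewrite ler_wpM2r ?normc_ge0 // ger0_norm ?divr_ge0 //.
by rewrite ler_pdivrMr ?ltr0n ?expn_gt0 // mul1r ler_nat.
Qed.

(** Goursat's contradiction at the common point [a] of the nested blocks: once the affine part of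
    [G] at [a] is removed, the values are at most [e] times the diameter, and diameter and perimeter
    are both of order [h], against a lower bound [c * h ^+ 2]. *)
Lemma not_large_block G c : (forall a, normc a <= 1 -> complex_differentiable G a) ->
  0 < c -> ~ large_block G 0 0 0 c.
Proof.
move=> Gd c0 /large_block_nested[p [q pq]].
have [|r rP] := @dyadic_nested p; first by move=> l; have [] := pq l.
have [|t tP] := @dyadic_nested q; first by move=> l; have [] := pq l.
pose a : R[i] := r%:C%C * expi (2 * pi * t).
have pi0 := @pi_gt0 R.
have a1 : normc a <= 1.
  rewrite normcM normc_real normc_expi mulr1.
  have := rP 0%N; have [_ _ _ -> _] := pq 0%N.
  by rewrite mul0r sub0r normrN expn0 invr1.
(* A grid point of the block differs from [a] by at most [2 * h] in radius and [4 * pi * h] in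
   angle, and [expi_lipschitz] doubles the latter. *)
pose D : R := 2 + 8 * pi.
have D0 : 0 < D by rewrite /D; lra.
have [v vP] := Gd a a1.
(* As [1 + 4 * pi = D / 2], this makes the bound of [block_bound] equal to [c / 4 * h ^+ 2]. *)
pose e : R := c / (8 * D ^+ 2).
have e0 : 0 < e by rewrite divr_gt0 // mulr_gt0 // exprn_gt0.
have [d d0 dP] := vP e e0.
have [l lD] : exists l, D * ((2 ^ l)%:R)^-1 < d.
  have [|l lP] := @expr_small R (2^-1) (d / D) _ (divr_gt0 d0 D0).
    by apply/andP; split; lra.
  exists l; rewrite mulrC -ltr_pdivlMr //; move: lP.
  by rewrite natrX exprVn.
pose h : R := ((2 ^ l)%:R)^-1.
have h0 : 0 < h by rewrite invr_gt0 ltr0n expn_gt0.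
have [_ _ pl _ bdl] := pq l.
have [n _] := bdl 0%N; rewrite leNgt => /negP; apply.
pose H (z : R[i]) := G z - ((G a - v * a) + v * z).
have -> : block G (l + n) (p l * 2 ^ n) (q l * 2 ^ n) (2 ^ n) =
   block H (l + n) (p l * 2 ^ n) (q l * 2 ^ n) (2 ^ n).
  by apply: eq_bigr => j _; apply: eq_bigr => k _; rewrite cell_affine.
have Js : (p l * 2 ^ n + 2 ^ n <= 2 ^ (l + n))%N.
  by rewrite -mulSnr expnD leq_mul2r pl orbT.
have n0 : 0 < (2 ^ n)%:R :> R by rewrite ltr0n expn_gt0.
have frac (x j : nat) (y : R) : (j <= 2 ^ n)%N -> `|x%:R / (2 ^ l)%:R - y| <= h ->
    `|(x * 2 ^ n + j)%:R / (2 ^ (l + n))%:R - y| <= 2 * h.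
  move=> jn xy.
  have -> : (x * 2 ^ n + j)%:R / (2 ^ (l + n))%:R =
    x%:R / (2 ^ l)%:R + j%:R / (2 ^ n)%:R * h :> R.
    rewrite /h expnD !natrD !natrM; field.
    by rewrite !natrX !expf_neq0 // pnatr_eq0.
  have j1 : 0 <= (j%:R / (2 ^ n)%:R : R) <= 1.
    by rewrite divr_ge0 //= ler_pdivrMr // mul1r ler_nat.
  have [j2 j3] := andP j1.
  have := ler_wpM2r (ltW h0) j3; have := mulr_ge0 j2 (ltW h0).
  move: xy; rewrite !ler_norml => /andP[? ?] ? ?; apply/andP; split; lra.
have HB j k : (j <= 2 ^ n)%N -> (k <= 2 ^ n)%N ->
    normc (H (polar_grid (l + n) (p l * 2 ^ n + j) (q l * 2 ^ n + k))) <= e * (D * h).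
  move=> jn kn; set z := polar_grid _ _ _.
  have za : normc (z - a) <= D * h.
    apply: le_trans (polar_grid_dist _ _ _ _) _.
      by apply: leq_trans Js; rewrite leq_add2l.
    have := frac _ _ _ jn (rP l).
    have -> (x : nat) : x%:R * (2 * pi / (2 ^ (l + n))%:R) - 2 * pi * t =
      2 * pi * (x%:R / (2 ^ (l + n))%:R - t) :> R by ring.
    have := frac _ _ _ kn (tP l); rewrite normrM (ger0_norm (x := 2 * pi)); last by lra.
    set y := `|_ - t|; set x := `|_ - r| => yh xh.
    have := ler_wpM2l (ltW pi0) yh; rewrite /D; lra.
  have -> : H z = G z - G a - v * (z - a) by rewrite /H; ring.
  apply: le_trans (dP z (le_lt_trans za lD)) _.
  by rewrite ler_wpM2l // ltW.
apply: le_lt_trans (block_bound Js HB) _.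
have -> : (2 ^ n)%:R * (4 * (e * (D * h)) * (1 + 4 * pi) / (2 ^ (l + n))%:R) =
  c / 4 * (h ^+ 2) :> R.
  have n1 := gt_eqF n0; have n2 := gt_eqF D0.
  have -> : 1 + 4 * pi = D / 2 :> R by rewrite /D; field.
  rewrite /e /h expnD natrM; field.
  by rewrite n2 n1 natrX expf_neq0 // pnatr_eq0.
have -> : (4 ^ l)%:R = (2 ^ l)%:R ^+ 2 :> R by rewrite -natrX -expnM mulnC expnM.
rewrite -exprVn -/h ltr_pM2r ?exprn_gt0 //; lra.
Qed.

(** Regrouped by nodes instead of edges, the sum has the factor [w^(k+1) - w^(k-1)] at the node
    [w ^+ k], with [w] the root of unity. *)
Lemma full_block G m : block G m 0 0 (2 ^ m) =
  (unity_root R (2 ^ m) - (unity_root R (2 ^ m))^-1) *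
  \sum_(k < 2 ^ m) G (unity_root R (2 ^ m) ^+ k) * unity_root R (2 ^ m) ^+ k.
Proof.
have M0 : (0 < 2 ^ m)%N by rewrite expn_gt0.
have M0' : (2 ^ m)%:R != 0 :> R[i] by rewrite pnatr_eq0 -lt0n.
set M := (2 ^ m)%N in M0 M0' *; set w := unity_root R M.
have wM : w ^+ M = 1 by exact: unity_rootX.
have w0 : w != 0 by exact: unity_root_neq0.
rewrite block_boundary [X in _ + X]big1 => [|j _]; last first.
  by rewrite /radial_edge /polar_grid -/M -/w !add0n wM expr0 subrr.
rewrite addr0; transitivity (\sum_(k < M) (G (w ^+ k) * (w ^+ k.+1 - w ^+ k) +
    G (w ^+ k.+1) * (w ^+ k.+1 - w ^+ k))).
  apply: eq_bigr => k _; rewrite /angular_edge /trapezoid /polar_grid -/M -/w !add0n.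
  by rewrite divff // !mul1r mul0r !mul0r subrr mulr0 subr0 mulrDl.
rewrite big_split /=.
have -> : \sum_(k < M) G (w ^+ k.+1) * (w ^+ k.+1 - w ^+ k) =
    \sum_(k < M) G (w ^+ k) * (w ^+ k - w ^+ k / w).
  pose u k := G (w ^+ k) * (w ^+ k - w ^+ k / w).
  have -> : \sum_(k < M) G (w ^+ k.+1) * (w ^+ k.+1 - w ^+ k) = \sum_(k < M) u k.+1.
    by apply: eq_bigr => k _; rewrite /u {5}exprS mulrAC divff // mul1r.
  have := sum_telescope u 0 M; rewrite sumrB add0n => /eqP.
  have -> : u M = u 0%N by rewrite /u wM expr0.
  by rewrite subrr subr_eq0 => /eqP.
rewrite -big_split mulr_sumr /=; apply: eq_bigr => k _; rewrite exprS; ring.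
Qed.

(** With [w] the root of unity, [2^(m-2)] steps of equal length [|w^2 - 1|] lead from 1 to -1, at
    distance 2. *)
Lemma unity_root_sub_conj m : (2 <= m)%N ->
  8 / (2 ^ m)%:R <= normc (unity_root R (2 ^ m) - (unity_root R (2 ^ m))^-1).
Proof.
case: m => [|[|m]] // _; set M := (2 ^ m.+2)%N; set w := unity_root R M.
have w0 : w != 0 by exact: unity_root_neq0.
have w1 : normc w = 1 by exact: normc_unity_root.
have M0 : 0 < M%:R :> R by rewrite ltr0n expn_gt0.
have -> : normc (w - w^-1) = normc (w ^+ 2 - 1).
  by rewrite -[LHS]mul1r -w1 -normcM mulrBr divff // expr2.
have wN : (w ^+ 2) ^+ (2 ^ m) = -1.
  rewrite -exprM -expiM.
  have -> : (2 * 2 ^ m)%:R * (2 * pi / M%:R) = pi :> R.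
    by rewrite /M !expnS !natrM; field; rewrite natrX expf_neq0 // pnatr_eq0.
  by rewrite /expi cospi sinpi; apply/eqP; rewrite eq_complex /= oppr0 !eqxx.
have h : 2 <= normc (w ^+ 2 - 1) * (2 ^ m)%:R.
  have -> : 2 = normc (((w ^+ 2) ^+ (2 ^ m)) - 1).
    by rewrite wN -opprD normcN -[1 + 1]/(2%:R) normc_nat.
  rewrite subrX1 normcM ler_wpM2l ?normc_ge0 //.
  apply: le_trans (normc_sum _ _ _) _.
  rewrite (eq_bigr (fun=> 1)) ?sumr_const ?card_ord // => i _.
  by rewrite !normcX w1 !expr1n.
rewrite ler_pdivrMr // /M !expnS !natrM; lra.
Qed.

Lemma discrete_cauchy G (e : R) :
  (forall a, normc a <= 1 -> complex_differentiable G a) -> 0 < e ->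
  exists m0, forall m, (m0 <= m)%N ->
    normc (\sum_(k < 2 ^ m) G (unity_root R (2 ^ m) ^+ k) * unity_root R (2 ^ m) ^+ k)
    < e * (2 ^ m)%:R.
Proof.
(* The 8 is the constant of [unity_root_sub_conj], by which the factor in [full_block] is bounded
   below. *)
move=> Gd e0; have := not_large_block Gd (_ : 0 < 8 * e).
move=> /(_ ltac:(lra)) nb; apply: contrapT => H; apply: nb => n0.
apply: contrapT => H'; apply: H; exists (maxn n0 2) => m; rewrite geq_max => /andP[n0m m2].
have M0 : 0 < (2 ^ m)%:R :> R by rewrite ltr0n expn_gt0.
rewrite ltNge; apply/negP => em; apply: H'; exists m => //.
rewrite add0n !mul0n full_block normcM.
have u := unity_root_sub_conj m2.
apply: le_trans (_ : 8 / (2 ^ m)%:R * (e * (2 ^ m)%:R) <= _).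
  by rewrite mulrCA divfK ?gt_eqF // mulrC.
by apply: ler_pM => //; rewrite ?divr_ge0 // mulr_ge0 // ltW.
Qed.

End Goursat.

(** * Holomorphic extensions are uniform limits of polynomials *)

Section Forward.
Variable R : realType.
Implicit Types (f F G : Cplx R -> Cplx R).

Lemma complex_differentiableM_id G (a : R[i]) : complex_differentiable G a ->
  complex_differentiable (fun z => G z * z) a.
Proof.
move=> [l lP]; exists (l * a + G a) => e e0.
have a0 := normc_ge0 a; have l0 := normc_ge0 l.
have e1 : 0 < e / (2 * (normc a + 1)) by rewrite divr_gt0 //; lra.
have e2 : 0 < e / (2 * (normc l + 1)) by rewrite divr_gt0 //; lra.
have [d d0 dP] := lP _ e1.
exists (Num.min d (Num.min 1 (e / (2 * (normc l + 1))))).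
  by rewrite !lt_min d0 ltr01.
move=> w; rewrite !lt_min => /and3P[wd wa1 wl].
have -> : G w * w - G a * a - (l * a + G a) * (w - a) =
  (G w - G a - l * (w - a)) * w + l * (w - a) * (w - a) by ring.
apply: le_trans (le_normcD _ _) _; rewrite !normcM.
have w1 : normc w <= normc a + 1.
  by have := normc_triangle a w 0; rewrite !subr0; lra.
have wa0 := normc_ge0 (w - a).
have h1 : normc (G w - G a - l * (w - a)) * normc w <= e / 2 * normc (w - a).
  have -> : e / 2 * normc (w - a) =
    e / (2 * (normc a + 1)) * normc (w - a) * (normc a + 1) by field; lra.
  by apply: ler_pM (normc_ge0 _) (normc_ge0 _) (dP w wd) w1.
have h2 : normc l * normc (w - a) <= e / 2.
  have -> : e / 2 = (normc l + 1) * (e / (2 * (normc l + 1))) by field; lra.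
  by apply: ler_pM => //; lra.
have := ler_wpM2r wa0 h2; lra.
Qed.

Lemma complex_differentiableM_exp G (a : R[i]) n : complex_differentiable G a ->
  complex_differentiable (fun z => G z * z ^+ n) a.
Proof.
move=> Ga; elim: n => [|n IH].
  have -> : (fun z : R[i] => G z * z ^+ 0) = G by apply/funext => z; rewrite mulr1.
  exact: Ga.
have -> : (fun z : R[i] => G z * z ^+ n.+1) = (fun z => G z * z ^+ n * z).
  by apply/funext => z; rewrite exprSr mulrA.
exact: complex_differentiableM_id.
Qed.

Lemma complex_differentiable_dilate G (s : R) (a : R[i]) : 0 < s ->
  complex_differentiable G (s%:C%C * a) ->
  complex_differentiable (fun z => G (s%:C%C * z)) a.
Proof.
move=> s0 [l lP]; exists (l * s%:C%C) => e e0.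
have [d d0 dP] := lP (e / s) (divr_gt0 e0 s0).
have sn (x : R[i]) : normc (s%:C%C * x) = s * normc x.
  by rewrite normcM normc_real gtr0_norm.
exists (d / s) => [|w wd]; first by rewrite divr_gt0.
have := dP (s%:C%C * w); rewrite -mulrBr sn mulrA divfK ?gt_eqF // mulrA; apply.
by rewrite mulrC -ltr_pdivlMr.
Qed.

(** [F] need not be differentiable on the circle, where [discrete_cauchy] asks for it. The dilates
    [F (s z)] with [s < 1] are, and uniform continuity brings them close to [f]. *)
Lemma approximable_of_extends f : extends_holomorphically f -> approximable f.
Proof.
move=> [F [Fc Fh Ff]].
have Fu := within_ucont (@closed_disc_compact R) Fc.
apply: approximable_limit => e e0.
have [d d0 dP] := Fu e e0.
(* On the circle [|z - s z| = 1 - s], which must be less than [d]; the bound [1 / 2] keeps [s]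
   positive. *)
pose s : R := 1 - Num.min (d / 2) (1 / 2).
have m1 : Num.min (d / 2) (1 / 2) <= 1 / 2 by rewrite ge_min lexx orbT.
have m2 : Num.min (d / 2) (1 / 2) <= d / 2 by rewrite ge_min lexx.
have m0 : 0 < Num.min (d / 2) (1 / 2) by rewrite lt_min; apply/andP; split; lra.
have s0 : 0 < s by rewrite /s; lra.
have s1 : s < 1 by rewrite /s; lra.
have sn (x : R[i]) : normc (s%:C%C * x) = s * normc x.
  by rewrite normcM normc_real gtr0_norm.
exists (fun z => F (s%:C%C * z)); last first.
  move=> z zc; rewrite -Ff //; move/circleE: zc => z1.
  apply: dP; try by apply/closed_discE; rewrite ?sn z1; lra.
  rewrite -[X in X - _]mul1r -mulrBl -(rmorph1 (real_complex R)) -rmorphB /=.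
  by rewrite normcM z1 normc_real mulr1 ger0_norm /s; lra.
have Gd n a : normc a <= 1 -> complex_differentiable (fun z => F (s%:C%C * z) * z ^+ n) a.
  move=> a1; apply: (@complex_differentiableM_exp (fun z => F (s%:C%C * z))).
  apply: complex_differentiable_dilate => //.
  apply/derivable_normcP; apply: Fh; apply/discE; rewrite sn.
  by apply: le_lt_trans (ler_wpM2l (ltW s0) a1) _; rewrite mulr1.
apply: approximable_moments => [|n r n0 r0].
  move=> r r0; have [b b0 bP] := Fu r r0; exists b => // z w /circleE z1 /circleE w1 zw.
  apply: bP; try by apply/closed_discE; rewrite sn ?z1 ?w1; lra.
  rewrite -mulrBr sn; apply: le_lt_trans zw; rewrite -[leRHS]mul1r.
  by rewrite ler_wpM2r ?normc_ge0 // ltW.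
(* [n.-1] because [discrete_cauchy] supplies one factor [z] itself, the trace of [dz]. *)
have [m0' mP] := discrete_cauchy (Gd n.-1) r0.
exists m0' => m mm; have := mP m mm.
rewrite (eq_bigr (fun k : 'I_(2 ^ m) => F (s%:C%C * unity_root R (2 ^ m) ^+ k) *
  (unity_root R (2 ^ m) ^+ k) ^+ n)) // => k _.
by rewrite -mulrA -exprSr prednK.
Qed.

End Forward.

(** * The Caratheodory-Fejer problem *)

Section TopSingularVector.
Variable R : realType.
Local Open Scope sesquilinear_scope.

Definition row_norm2 n (w : 'rV[R[i]]_n) : R := \sum_(i < n) normc (w 0 i) ^+ 2.

Lemma row_norm2E n (w : 'rV[R[i]]_n) : (w *m w ^t*) 0 0 = (row_norm2 w)%:C%C.
Proof.
rewrite !mxE rmorph_sum; apply: eq_bigr => i _.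
by rewrite !mxE -normCK normcE rmorphXn.
Qed.

(** The spectral theorem for the Hermitian matrix [A *m A ^t*]: in an orthonormal eigenbasis
    [row_norm2 (w *m A)] is a diagonal form, and its largest coefficient is the maximum. *)
Lemma top_singular_vector n (A : 'M[R[i]]_n) : (0 < n)%N ->
  exists2 L : R, 0 <= L & (forall w, row_norm2 (w *m A) <= L * row_norm2 w) /\
    exists2 v, v != 0 & row_norm2 (v *m A) = L * row_norm2 v.
Proof.
move=> n0; pose H := A *m A ^t*.
have Hh : H ^t* = H.
  by rewrite /H trmx_mul map_mxM /= map_trmx trmxK -map_mx_comp (map_mx_id (@conjCK _)).
have /orthomx_spectralP HE : H \is normalmx by apply/normalmxP; rewrite Hh.
have Pu := spectral_unitarymx H.
rewrite (invmx_unitary Pu) in HE.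
set P := spectralmx H in HE Pu; set d := spectral_diag H in HE.
have PP : P ^t* *m P = 1%:M.
  by rewrite -(invmx_unitary Pu) mulVmx // unitarymx_unit.
have PP' : P *m P ^t* = 1%:M by apply/unitarymxP.
have tK (m k : nat) (B : 'M[R[i]]_(m, k)) : (B ^t*) ^t* = B by exact: trmxCK.
have tM (m k l : nat) (B : 'M[R[i]]_(m, k)) (C : 'M[R[i]]_(k, l)) :
  (B *m C) ^t* = C ^t* *m B ^t* by rewrite trmx_mul map_mxM.
have nP (w : 'rV[R[i]]_n) : row_norm2 (w *m P ^t*) = row_norm2 w.
  by apply: complexI; rewrite -!row_norm2E tM tK mulmxA mulmxKtV // ?tK ?Pu.
have nA (w : 'rV[R[i]]_n) : (row_norm2 (w *m A))%:C%C =
    \sum_i d 0 i * ((normc ((w *m P ^t*) 0 i)) ^+ 2)%:C%C.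
  rewrite -row_norm2E tM mulmxA -(mulmxA w) -/H HE.
  have -> : w *m (P ^t* *m diag_mx d *m P) *m w ^t* =
      (w *m P ^t*) *m diag_mx d *m (w *m P ^t*) ^t*.
    by rewrite tM tK !mulmxA.
  rewrite mxE; apply: eq_bigr => i _; rewrite mul_mx_diag !mxE.
  rewrite [_ * d 0 i]mulrC -mulrA; congr (_ * _).
  by rewrite -normCK normcE rmorphXn.
pose e (i : 'I_n) : 'rV[R[i]]_n := delta_mx 0 i *m P.
have eP i : e i *m P ^t* = delta_mx 0 i by rewrite /e -mulmxA PP' mulmx1.
(* Being squared norms of images of unit eigenvectors, the complex eigenvalues are real and
   nonnegative, and can be compared. *)
have de i : d 0 i = (row_norm2 (e i *m A))%:C%C.
  rewrite nA (bigD1 i) //= big1 => [|j ji].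
    by rewrite eP mxE !eqxx normc1 expr1n addr0 mulr1.
  by rewrite eP mxE eqxx (negPf ji) normc0 expr0n mulr0.
pose rd i : R := row_norm2 (e i *m A).
have rd0 i : 0 <= rd i by apply: sumr_ge0 => j _; rewrite exprn_ge0 // normc_ge0.
have nAR (w : 'rV[R[i]]_n) : row_norm2 (w *m A) =
    \sum_i rd i * (normc ((w *m P ^t*) 0 i)) ^+ 2.
  apply: complexI; rewrite nA rmorph_sum; apply: eq_bigr => i _.
  by rewrite de; apply/esym; exact: rmorphM.
pose i0 := Ordinal n0.
have [j jm] : exists j, forall i, rd i <= rd j.
  exists [arg max_(i > i0) rd i]%O => i.
  by case: (@arg_maxP _ _ _ i0 xpredT rd isT) => k _ kP; exact: kP.
exists (rd j) => //; split=> [w|].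
  rewrite nAR -(nP w) /row_norm2 [leRHS]mulr_sumr; apply: ler_sum => i _.
  by apply: ler_wpM2r (jm i); rewrite exprn_ge0 ?normc_ge0.
have ne : row_norm2 (e j) = 1.
  rewrite -nP eP /row_norm2 (bigD1 j) //= big1 => [|i ij].
    by rewrite mxE !eqxx normc1 expr1n addr0.
  by rewrite mxE eqxx (negPf ij) normc0 expr0n.
exists (e j); last by rewrite ne mulr1.
apply/eqP => e0; move: ne; rewrite e0 /row_norm2 big1 => [|i _].
  by move/eqP; rewrite eq_sym oner_eq0.
by rewrite mxE normc0 expr0n.
Qed.

End TopSingularVector.

(** * Extremal polynomials for multiplication by [s] modulo [X^n] *)

Section CaratheodoryFejer.
Variable R : realType.
Variables (n : nat) (s : {poly R[i]}).
Hypothesis n0 : (0 < n)%N.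
Implicit Types (p q u v g : {poly R[i]}) (z a : R[i]).

(** Only the first [n] coefficients count, so [coef_norm2 (s * u)] is the squared norm of [s * u]
    modulo [X^n]. *)
Definition coef_norm2 p : R := \sum_(i < n) normc p`_i ^+ 2.

Definition coef_dot p q : R[i] := \sum_(i < n) p`_i * (q`_i)^*%C.

Lemma coef_dotE p : coef_dot p p = (coef_norm2 p)%:C%C.
Proof. by rewrite rmorph_sum; apply: eq_bigr => i _; rewrite mul_conjc. Qed.

Lemma coef_dotC p q : coef_dot q p = (coef_dot p q)^*%C.
Proof.
by rewrite rmorph_sum; apply: eq_bigr => i _; rewrite rmorphM /= conjcK mulrC.
Qed.

Lemma coef_dotDl p q v : coef_dot (p + q) v = coef_dot p v + coef_dot q v.
Proof. by rewrite -big_split; apply: eq_bigr => i _; rewrite coefD mulrDl. Qed.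

Lemma coef_dotZl (c : R[i]) p q : coef_dot (c *: p) q = c * coef_dot p q.
Proof. by rewrite mulr_sumr; apply: eq_bigr => i _; rewrite coefZ mulrA. Qed.

Lemma coef_dotDr p q v : coef_dot v (p + q) = coef_dot v p + coef_dot v q.
Proof. by rewrite ![coef_dot v _]coef_dotC coef_dotDl rmorphD. Qed.

Lemma coef_dotZr (c : R[i]) p q : coef_dot p (c *: q) = c^*%C * coef_dot p q.
Proof. by rewrite ![coef_dot p _]coef_dotC coef_dotZl rmorphM. Qed.

Lemma coef_dot_trunc p q p' q' : (forall i, (i < n)%N -> p`_i = p'`_i) ->
  (forall i, (i < n)%N -> q`_i = q'`_i) -> coef_dot p q = coef_dot p' q'.
Proof. by move=> pp qq; apply: eq_bigr => i _; rewrite pp // qq. Qed.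

Lemma coefM_trunc p q q' : (forall i, (i < n)%N -> q`_i = q'`_i) ->
  forall i, (i < n)%N -> (p * q)`_i = (p * q')`_i.
Proof.
move=> qq i iN; rewrite !coefMr; apply: eq_bigr => j _.
by rewrite qq // (leq_ltn_trans _ iN) // -ltnS.
Qed.

Definition extremal L u := [/\ (size u <= n)%N, u != 0 &
  coef_norm2 (s * u) = L * coef_norm2 u].

Lemma extremal_exists : exists2 L : R, 0 <= L &
  (forall v, (size v <= n)%N -> coef_norm2 (s * v) <= L * coef_norm2 v) /\
  exists u, extremal L u.
Proof.
pose A : 'M[R[i]]_n := \matrix_(i, j) (s * 'X^i)`_j.
pose row_of v : 'rV[R[i]]_n := \row_(i < n) v`_i.
have nE v : row_norm2 (row_of v) = coef_norm2 v.
  by apply: eq_bigr => i _; rewrite mxE.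
have nAE v : (size v <= n)%N -> row_norm2 (row_of v *m A) = coef_norm2 (s * v).
  move=> vn; apply: eq_bigr => j _; congr (normc _ ^+ 2); rewrite mxE.
  rewrite -[in RHS](take_poly_id vn) /take_poly poly_def mulr_sumr coef_sum.
  by apply: eq_bigr => i _; rewrite !mxE -scalerAr coefZ.
have [L L0 [LA [w w0 wE]]] := top_singular_vector A n0.
exists L => //; split=> [v vn|]; first by rewrite -nAE // -nE.
pose u : {poly R[i]} := rVpoly w.
have un : (size u <= n)%N by exact: size_poly.
have uw : row_of u = w by apply/rowP => i; rewrite mxE coef_rVpoly_ord.
exists u; split=> //; last by rewrite -nAE // -nE uw.
by apply/eqP => uE; move: w0; rewrite -uw uE; case/eqP; apply/rowP => i; rewrite !mxE coef0.
Qed.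

Variable L : R.
Hypothesis L0 : 0 <= L.
Hypothesis Lmax : forall v, (size v <= n)%N ->
  coef_norm2 (s * v) <= L * coef_norm2 v.

(** The form [L |v|^2 - |s v|^2] is nonnegative and vanishes at [u], so [u] lies in its kernel. The
    value at [u + c v] with [c = - r b] is [- 2 r |b|^2 + r^2 |b|^2 K], which is negative for small
    [r] unless [b = 0]. *)
Lemma extremal_orth u v : extremal L u -> (size v <= n)%N ->
  coef_dot (s * u) (s * v) = L%:C%C * coef_dot u v.
Proof.
move=> [un _ uE] vn.
pose b := L%:C%C * coef_dot u v - coef_dot (s * u) (s * v).
pose K := L * coef_norm2 v - coef_norm2 (s * v).
have K0 : 0 <= K by rewrite subr_ge0 Lmax.
(* Small enough for [r * K <= 1]; the added 1 covers [K = 0]. *)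
pose r := (K + 1)^-1.
have r0 : 0 < r by rewrite invr_gt0; lra.
pose c : R[i] := - (r%:C%C * b).
have cn : (size (u + c *: v)%R <= n)%N.
  rewrite (leq_trans (size_polyD _ _)) // geq_max un /=.
  exact: leq_trans (size_scale_leq _ _) vn.
have := Lmax cn.
have exp p q : coef_norm2 (p + c *: q) =
    coef_norm2 p + 2 * Re (c^*%C * coef_dot p q) + normc c ^+ 2 * coef_norm2 q.
  apply: complexI; rewrite -coef_dotE !(coef_dotDl, coef_dotDr, coef_dotZl, coef_dotZr).
  rewrite (coef_dotC p q) !coef_dotE !rmorphD (rmorphM (real_complex R) 2).
  rewrite (rmorphM (real_complex R) (normc c ^+ 2)) /= -mul_conjc.
  have -> : c * (coef_dot p q)^*%C = (c^*%C * coef_dot p q)^*%C.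
    by rewrite rmorphM /= conjcK.
  have := addcJ (c^*%C * coef_dot p q); rewrite rmorph_nat => <-; ring.
rewrite mulrDr -scalerAr !exp uE.
have -> : L * (coef_norm2 u + 2 * Re (c^*%C * coef_dot u v) + normc c ^+ 2 * coef_norm2 v) =
   L * coef_norm2 u + 2 * Re (c^*%C * (L%:C%C * coef_dot u v)) + normc c ^+ 2 * (L * coef_norm2 v).
  have -> : Re (c^*%C * (L%:C%C * coef_dot u v)) = L * Re (c^*%C * coef_dot u v).
    by case: (c^*%C) => ? ?; case: (coef_dot u v) => ? ? /=; ring.
  ring.
have cb : Re (c^*%C * (L%:C%C * coef_dot u v)) - Re (c^*%C * coef_dot (s * u) (s * v)) =
    - (r * normc b ^+ 2).
  have cJ : c^*%C = - (r%:C%C * b^*%C).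
    rewrite /c (rmorphN (@conjc R)) (rmorphM (@conjc R)).
    by congr (- (_ * _)); exact: conjc_real.
  rewrite -raddfB -mulrBr -/b cJ mulNr -mulrA [b^*%C * b]mulrC.
  by rewrite mul_conjc -rmorphM.
have nc : normc c ^+ 2 = r ^+ 2 * normc b ^+ 2.
  by rewrite normcN normcM normc_real exprMn gtr0_norm.
have rK : r * K <= 1 by rewrite /r mulrC ler_pdivrMr; lra.
move: nc cb; set B := normc b ^+ 2; set x := Re _; set y := Re _ => nc cb ineq.
have B0 : 0 <= B by rewrite exprn_ge0 ?normc_ge0.
have : 2 * (r * B) <= r * B * (r * K).
  have -> : r * B * (r * K) = r ^+ 2 * B * K by ring.
  rewrite -nc /K; lra.
have rB0 : 0 <= r * B by rewrite mulr_ge0 // ltW.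
have := ler_wpM2l rB0 rK => h1 h2.
have rB : r * B <= 0 by lra.
have : B = 0 by apply/eqP; rewrite eq_le B0 andbT -(pmulr_rle0 _ r0).
move/eqP; rewrite sqrf_eq0 normc_eq0 subr_eq0 => /eqP -> //.
Qed.

(* With [P_i] the partial sums of the [a_i],
   [|sum a_i|^2 = 2 Re (sum a_i conj P_i) - sum |a_i|^2]. *)
Lemma normc_sum_sqr (c : nat -> R[i]) m :
  (\sum_(i < m) c i) * (\sum_(i < m) c i)^*%C =
  \sum_(i < m) c i * (\sum_(j < i.+1) c j)^*%C +
  (\sum_(i < m) c i * (\sum_(j < i.+1) c j)^*%C)^*%C
  - \sum_(i < m) c i * (c i)^*%C.
Proof.
elim: m => [|m IH]; first by rewrite !big_ord0 conjc0; ring.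
rewrite ![\sum_(i < m.+1) _]big_ord_recr /=.
move: IH; set P := \sum_(i < m) c i; set N := \sum_(i < m) c i * (c i)^*%C.
set S := \sum_(i < m) _; move: P S N (c m) => P S N d IH.
have -> : N = S + S^*%C - P * P^*%C by rewrite IH; ring.
rewrite (rmorphD (@conjc R) S) (rmorphD (@conjc R) P) (rmorphM (@conjc R)) /=.
by rewrite (rmorphD (@conjc R) P^*%C) /= !conjcK; ring.
Qed.

(** The truncated series of [1 / (1 - conj z X)]. On the circle, coefficient [i] of
    [geom_poly z * p] with [i < n] is [conj z ^ i] times the partial sum of [p.[z]] up to degree
    [i]. *)
Definition geom_poly z : {poly R[i]} := \poly_(k < n) (z^*%C ^+ k).

(** A value at a single point becomes a product of coefficient vectors, a form to which
    [extremal_orth] applies. *)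
Lemma normc_circle_sqr p z : normc z = 1 -> (size p <= n)%N ->
  (normc p.[z] ^+ 2)%:C%C = coef_dot p (geom_poly z * p) +
    (coef_dot p (geom_poly z * p))^*%C - coef_dot p p.
Proof.
move=> z1 pn; rewrite -mul_conjc (horner_coef_wide z pn).
have zz k : z ^+ k * (z ^+ k)^*%C = 1 by rewrite mul_conjc normcX z1 !expr1n.
rewrite (@normc_sum_sqr (fun i => p`_i * z ^+ i)).
have -> : coef_dot p (geom_poly z * p) =
    \sum_(i < n) p`_i * z ^+ i * (\sum_(j < i.+1) p`_j * z ^+ j)^*%C.
  apply: eq_bigr => i _; rewrite -mulrA; congr (_ * _).
  rewrite coefMr !rmorph_sum mulr_sumr; apply: eq_bigr => j _.
  have ji : (j <= i)%N by rewrite -ltnS.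
  rewrite coef_poly (leq_ltn_trans (leq_subr _ _) (ltn_ord i)).
  rewrite !rmorphM !rmorphXn /= conjcK mulrCA [RHS]mulrC; congr (_ * _).
  have -> : z ^+ i = z ^+ (i - j) * z ^+ j by rewrite -exprD subnK.
  by rewrite -mulrA -(rmorphXn (@conjc R)) zz mulr1.
by congr (_ - _); apply: eq_bigr => i _; rewrite rmorphM mulrACA zz mulr1.
Qed.

(** [extremal_orth] against [v = geom_poly z * u] modulo [X^n]: multiplication by [s] and by
    [geom_poly z] commute, so [s * v] agrees with [geom_poly z * y] up to degree [n]. *)
Lemma extremal_circle u z : extremal L u -> normc z = 1 ->
  normc (take_poly n (s * u)).[z] ^+ 2 = L * normc u.[z] ^+ 2.
Proof.
move=> eu z1; have [un _ uE] := eu; apply: complexI; rewrite (rmorphM (real_complex R) L) /=.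
set y := take_poly n (s * u); set g := geom_poly z.
have yE i : (i < n)%N -> y`_i = (s * u)`_i by move=> iN; rewrite coef_take_poly iN.
rewrite !normc_circle_sqr // ?size_take_poly //.
have -> : coef_dot y (g * y) = L%:C%C * coef_dot u (g * u).
  pose v := take_poly n (g * u).
  have vE i : (i < n)%N -> v`_i = (g * u)`_i by move=> iN; rewrite coef_take_poly iN.
  rewrite -(@coef_dot_trunc u v u (g * u)) // -extremal_orth ?size_take_poly //.
  apply: coef_dot_trunc => // i iN; rewrite (coefM_trunc _ yE iN) (coefM_trunc s vE iN).
  by rewrite mulrCA.
rewrite (@coef_dot_trunc y y (s * u) (s * u)) // !coef_dotE uE.
rewrite (rmorphM (real_complex R)) /=.
have -> : (L%:C%C * coef_dot u (g * u))^*%C = L%:C%C * (coef_dot u (g * u))^*%C.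
  by rewrite (rmorphM (@conjc R)); congr (_ * _); exact: conjc_real.
ring.
Qed.

Lemma circle_avoiding a : exists2 c : R[i], normc c = 1 &
  forall k, c * unity_root R n ^+ k != a.
Proof.
have wn k : normc (unity_root R n ^+ k) = 1 by rewrite normcX normc_unity_root expr1n.
have [a1|a1] := eqVneq (normc a) 1; last first.
  exists 1; first by rewrite normc1.
  by move=> k; apply: contraNneq a1 => <-; rewrite mul1r wn.
(* Half a step away from [a]: the [n]-th power of [expi (pi / n)] is -1, that of a ratio of two
   nodes is 1. *)
exists (a * expi (pi / n%:R)); first by rewrite normcM a1 normc_expi mulr1.
move=> k; apply/eqP => E.
have a0 : a != 0 by rewrite -normc_gt0 a1.
have : expi (pi / n%:R) * unity_root R n ^+ k = 1.
  by apply: (mulfI a0); rewrite mulrA E mulr1.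
move/(congr1 (fun x => x ^+ n)); rewrite expr1n exprMn exprAC unity_rootX // expr1n mulr1.
rewrite -expiM mulrC divfK ?pnatr_eq0 -?lt0n // /expi cospi sinpi.
by case=> /eqP; rewrite eq_sym -subr_eq0 opprK -[1 + 1]/(2%:R) pnatr_eq0.
Qed.

(* Deflating a root in the closed disc keeps a vector extremal: for [|a| < 1]
   compare [u = (X - a) v] with [(1 - conj a X) v], which has the same modulus
   on the circle. *)
Lemma extremal_deflate u a : extremal L u -> root u a -> normc a <= 1 ->
  exists2 v, extremal L v & (size v < size u)%N.
Proof.
move=> eu ua a1; have [un u0 uE] := eu.
have /factor_theorem[v vE] := ua.
have v0 : v != 0 by apply: contraNneq u0 => v0; rewrite vE v0 mul0r.
have su : size u = (size v).+1 by rewrite vE size_Mmonic ?monicXsubC // size_XsubC addn2.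
have vn : (size v <= n)%N by rewrite (leq_trans _ un) // su.
exists v; last by rewrite su.
split=> //.
pose x := take_poly n (s * v); pose y := take_poly n (s * u).
pose w := drop_poly n (s * v).
have svE : s * v = x + w * 'X^n by rewrite poly_take_drop.
have xn : (size x <= n)%N by exact: size_take_poly.
(* The obstruction to [y = (X - a) x]: multiplying by a linear factor before or after truncation
   differs by its leading coefficient times [t], at [X^n]. *)
pose t := x`_n.-1.
pose aX := 'X - a%:P : {poly R[i]}; pose aY := 1 - a^*%C *: 'X : {poly R[i]}.
have topc (c d : R[i]) : take_poly n ((c%:P + d *: 'X) * (s * v)) =
    (c%:P + d *: 'X) * x - (d * t) *: 'X^n.
  have [m nm] : exists m, n = m.+1 by exists n.-1; rewrite prednK.
  apply/polyP => i; rewrite coef_take_poly svE mulrDr coefD mulrA coefMXn.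
  rewrite coefB coefZ coefXn; case: (ltngtP i n) => [iN|ni|->].
  - by rewrite addr0 mulr0 subr0.
  - rewrite mulr0 subr0 mulrDl mul_polyC -scalerAl coefD !coefZ coefXM.
    rewrite (nth_default _ (leq_trans xn (ltnW ni))) mulr0 add0r.
    by case: ifP => _; rewrite ?mulr0 // nth_default ?mulr0 // (leq_trans xn) //; move: ni; lia.
  - rewrite mulr1 mulrDl mul_polyC -scalerAl coefD !coefZ coefXM.
    by rewrite (nth_default _ xn) mulr0 add0r /t nm /= subrr.
have aXE : aX = (- a)%:P + 1 *: 'X by rewrite /aX polyCN scale1r addrC.
have aYE : aY = 1%:P + (- a^*%C) *: 'X by rewrite /aY scaleNr.
have yE : y = aX * x - t *: 'X^n.
  by rewrite /y vE mulrA [s * v * _]mulrC -/aX aXE topc mul1r.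
have ty : t = 0.
  move: (a1); rewrite le_eqVlt => /predU1P[aa|aa].
    (* For [a] on the circle, [|y|^2 = L |u|^2] vanishes at [a], as does [(X - a) x], so
       [t * a ^+ n = 0]. *)
    have := extremal_circle eu aa; rewrite -/y (rootP ua) normc0 expr0n mulr0.
    move/eqP; rewrite sqrf_eq0 normc_eq0 yE hornerD hornerM hornerN hornerZ hornerXn.
    rewrite hornerXsubC subrr mul0r sub0r oppr_eq0 mulf_eq0 => /orP[/eqP //|].
    by rewrite expf_eq0 -normc_eq0 aa oner_eq0 andbF.
  (* Equal moduli on the circle give equal norms: [|y|^2 + |t|^2 = |y'|^2 + |a|^2 |t|^2]. Maximality
     gives [|y'| <= |y|], so [|a| < 1] forces [t = 0]. *)
  pose u' := aY * v; pose y' := take_poly n (s * u').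
  have aY2 : (size aY <= 2)%N.
    rewrite aYE (leq_trans (size_polyD _ _)) // geq_max size_polyC oner_eq0 /=.
    by rewrite (leq_trans (size_scale_leq _ _)) // size_polyX.
  have u'n : (size u' <= n)%N.
    rewrite (leq_trans (size_polyMleq _ _)) //; move: aY2 un; rewrite su.
    by move: (size aY) (size v) => A B; lia.
  have y'E : y' = aY * x + (a^*%C * t) *: 'X^n.
    by rewrite /y' /u' mulrCA aYE topc [- _ * t]mulNr [- (_ * t) *: _]scaleNr opprK.
  have circ z : normc z = 1 -> normc aX.[z] = normc aY.[z].
    move=> z1; rewrite hornerXsubC hornerD hornerN hornerZ hornerX hornerC.
    have z0 : z != 0 by rewrite -normc_gt0 z1.
    have -> : 1 - a^*%C * z = z * (z - a)^*%C.
      by rewrite (rmorphB (@conjc R)) /= (conjc_circle z1) mulrBr divff // mulrC.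
    by rewrite normcM z1 mul1r normc_conj.
  have nn m p : (size p < m)%N -> \sum_(i < m) normc (aX * p)`_i ^+ 2 =
      \sum_(i < m) normc (aY * p)`_i ^+ 2.
    move=> pm; have m0 : m%:R != 0 :> R by rewrite pnatr_eq0 -lt0n (leq_ltn_trans _ pm).
    have sX : (size (aX * p)%R <= m)%N.
      rewrite (leq_trans (size_polyMleq _ _)) // size_XsubC; move: pm.
      by move: (size p) => A; lia.
    have sY : (size (aY * p)%R <= m)%N.
      rewrite (leq_trans (size_polyMleq _ _)) //; move: pm aY2.
      by move: (size p) (size aY) => A B; lia.
    apply: (mulfI m0); rewrite -(parseval (normc1 R) sX) -(parseval (normc1 R) sY).
    apply: eq_bigr => k _; rewrite !hornerM !normcM circ // normcM normc1 mul1r.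
    by rewrite normcX normc_unity_root expr1n.
  have nu : coef_norm2 u' = coef_norm2 u.
    by rewrite vE mulrC /coef_norm2 nn // (leq_trans _ un) // su.
  have cn c p : (size p <= n.+1)%N -> p`_n = c -> coef_norm2 (p - c *: 'X^n) + normc c ^+ 2 =
      \sum_(i < n.+1) normc p`_i ^+ 2.
    move=> pn pc; rewrite big_ord_recr /= pc; congr (_ + _); apply: eq_bigr => i _.
    by rewrite coefB coefZ coefXn (ltn_eqF (ltn_ord i)) mulr0 subr0.
  have top c d : ((c%:P + d *: 'X) * x)`_n = d * t.
    have := congr1 (fun p => p`_n) (topc c d).
    rewrite coef_take_poly ltnn coefB coefZ coefXn eqxx mulr1 => /esym/eqP.
    by rewrite subr_eq0 => /eqP.
  have e1 : coef_norm2 y + normc t ^+ 2 = \sum_(i < n.+1) normc (aX * x)`_i ^+ 2.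
    rewrite yE cn //; last by rewrite aXE top mul1r.
    by rewrite (leq_trans (size_polyMleq _ _)) // size_XsubC.
  have e2 : coef_norm2 y' + normc (a^*%C * t) ^+ 2 = \sum_(i < n.+1) normc (aY * x)`_i ^+ 2.
    rewrite y'E -[a^*%C * t]opprK scaleNr normcN cn //; last by rewrite aYE top mulNr.
    rewrite (leq_trans (size_polyMleq _ _)) //; move: xn aY2.
    by move: (size x) (size aY) => A B; lia.
  have trn p : coef_norm2 (take_poly n p) = coef_norm2 p.
    by apply: eq_bigr => i _; rewrite coef_take_poly ltn_ord.
  have := Lmax u'n; rewrite nu -uE -(trn (s * u')) -(trn (s * u)) -/y -/y' => ineq.
  have := nn n.+1 x xn; rewrite -e1 -e2 normcM normc_conj exprMn => E.
  have aa2 : normc a ^+ 2 < 1 by rewrite expr_lt1 ?normc_ge0.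
  have t2 : 0 <= normc t ^+ 2 by rewrite exprn_ge0 ?normc_ge0.
  have : normc t ^+ 2 = 0.
    apply/eqP; rewrite eq_le t2 andbT leNgt; apply/negP => tp.
    have : normc a ^+ 2 * normc t ^+ 2 < 1 * normc t ^+ 2 by rewrite ltr_pM2r.
    lra.
  by move/eqP; rewrite sqrf_eq0 normc_eq0 => /eqP.
have yx : y = aX * x by rewrite yE ty scale0r subr0.
(* Cancelling [|z - a|^2] in [|y|^2 = L |u|^2] requires nodes other than [a]; Parseval over [n] such
   nodes returns the norms of [x] and [v]. *)
have [c c1 ca] := circle_avoiding a.
have nR : n%:R != 0 :> R by rewrite pnatr_eq0 -lt0n.
have -> : coef_norm2 (s * v) = coef_norm2 x.
  by apply: eq_bigr => i _; rewrite coef_take_poly ltn_ord.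
apply: (mulfI nR); rewrite mulrCA -(parseval c1 xn) -(parseval c1 vn) mulr_sumr.
apply: eq_bigr => k _; set z := c * _.
have z1 : normc z = 1 by rewrite normcM c1 normcX normc_unity_root expr1n mulr1.
have nz : normc aX.[z] ^+ 2 != 0.
  by rewrite sqrf_eq0 normc_eq0 hornerXsubC subr_eq0 ca.
apply: (mulfI nz); have := extremal_circle eu z1.
by rewrite -/y yx vE !hornerM !normcM !exprMn -/aX => ->; ring.
Qed.

End CaratheodoryFejer.

Lemma caratheodory_fejer (R : realType) n (s : {poly R[i]}) : (0 < n)%N ->
  exists L : R, exists u y w : {poly R[i]},
    [/\ 0 <= L, (forall z, root u z -> 1 < normc z), (size y <= n)%N,
        s * u = y + w * 'X^n &
        forall z, normc z = 1 -> normc y.[z] ^+ 2 = L * normc u.[z] ^+ 2].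
Proof.
move=> n0; have [L L0 [Lmax [u0 eu0]]] := extremal_exists s n0.
have [u [eu umin]] : exists u, extremal n s L u /\
    forall v, extremal n s L v -> (size u <= size v)%N.
  have ex : exists k, `[< exists2 u, extremal n s L u & size u = k >].
    by exists (size u0); apply/asboolP; exists u0.
  case: (ex_minnP ex) => k /asboolP[u eu <-] kmin; exists u; split=> // v ev.
  by apply: kmin; apply/asboolP; exists v.
exists L, u, (take_poly n (s * u)), (drop_poly n (s * u)); split=> //.
- move=> a ua; rewrite ltNge; apply/negP => a1.
  have [v /umin] := extremal_deflate n0 L0 Lmax eu ua a1.
  by rewrite leqNgt => /negP.
- exact: size_take_poly.
- by rewrite poly_take_drop.
- by move=> z z1; exact: (extremal_circle Lmax eu z1).
Qed.

(** * The argument principle *)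

Lemma ucont_bounded_below (R : realType) A (g : Cplx R -> Cplx R) :
  compact A -> ucont A g -> (forall z, A z -> g z != 0) ->
  exists2 m : R, 0 < m & forall z, A z -> m <= normc (g z).
Proof.
rewrite compact_near_coveringP => cA gu g0.
have : \forall m \near 0^'+, A `<=` (fun z => A z -> m <= normc (g z)).
  apply: cA => z Az.
  have m0 : 0 < normc (g z) / 2 by rewrite divr_gt0 // normc_gt0 g0.
  have [d d0 gd] := gu _ m0.
  exists ([set z' | normc (z' - z) < d], [set m : R | m < normc (g z) / 2]).
    split; first by apply/nbhs_normcP; exists d.
    exact: nbhs_right_lt.
  move=> [z' m] /= [z'z mz] Az'.
  have := gd z' z Az' Az z'z; have := normc_triangle (g z') (g z) 0.
  by rewrite !subr0 (normcB (g z)); lra.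
move=> /nbhs_ballP[d /= d0 dP]; have d2 : 0 < d / 2 by lra.
exists (d / 2) => // z Az; apply: (dP (d / 2) _ d2 z Az Az).
by rewrite /ball /= sub0r normrN gtr0_norm; lra.
Qed.

Section ArgumentPrinciple.
Variable R : realType.
Implicit Types (f g : Cplx R -> Cplx R).

Lemma circle_closed_disc (z : Cplx R) : circle z -> closed_disc z.
Proof. by move/circleE => z1; apply/closed_discE; rewrite z1. Qed.

Lemma approximable_change g : ucont (@circle R) g -> approximable g ->
  (forall z, circle z -> g z != 0) ->
  exists2 c : R, is_change_of_arg g c & 0 <= c.
Proof.
move=> gu ga g0; have [m m0 gm] := ucont_bounded_below (@circle_compact R) gu g0.
(* Within [m / 2] of [g], a polynomial keeps modulus above [m / 2] and thus dominates the error, as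
   [change_near] requires. *)
have m2 : 0 < m / 2 by lra.
have [p gp] := ga _ m2.
have pm z : circle z -> m / 2 < normc p.[z].
  move=> zc; have := normc_triangle p.[z] (g z) 0; rewrite !subr0.
  by have := gm z zc; have := gp z zc; lra.
have p0 z : circle z -> p.[z] != 0.
  by move=> /pm pz; rewrite -normc_gt0; lra.
have [n [pn _ _]] := change_poly p0.
exists (2 * pi * n%:R); last by rewrite !mulr_ge0 // pi_ge0.
have near z : circle z -> normc (g z - p.[z]) < normc p.[z].
  by move=> zc; exact: lt_trans (gp z zc) (pm z zc).
exact: (change_near (ucont_ccont gu) (@ccont_horner R p) near pn).
Qed.

Lemma change_exp_id (n : nat) :
  is_change_of_arg (fun z : Cplx R => z ^+ n) (2 * pi * n%:R).
Proof.
elim: n => [|n IH].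
  by rewrite mulr0; apply: change_ext (change_cst 1) => z _.
have -> : 2 * pi * n.+1%:R = 2 * pi * n%:R + 2 * pi :> R.
  by rewrite -natr1; move: (2 * @pi R) => c; ring.
apply: change_ext (change_mul IH (change_id R)) => z _.
by rewrite exprSr.
Qed.

Lemma approximable_of_change f : ucont (@circle R) f ->
  (forall P : {poly R[i]}, (forall z, circle z -> f z + P.[z] != 0) ->
     exists2 c : R, is_change_of_arg (fun z => f z + P.[z]) c & 0 <= c) ->
  approximable f.
Proof.
(* The two approximations cost [e / 4] each, so [f - q] is within [e / 2] of [h], which is also the
   threshold for [Num.sqrt L]. *)
move=> fu fP e e0; have e4 : 0 < e / 4 by lra.
have [N [s N0 fs]] := fejer_laurent fu e4.
have [L [u [y [w [L0 uroot yN suE Ly]]]]] := caratheodory_fejer s N0.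
have u0 z : normc z = 1 -> u.[z] != 0.
  by move=> z1; apply/negP => /uroot; rewrite z1 ltxx.
have wu := approximableM (approximable_poly w) (approximable_polyV uroot).
have [q wq] := wu _ e4.
pose h (z : Cplx R) : Cplx R := y.[z] * (u.[z]^-1 * (z ^+ N)^-1).
have hL z : circle z -> normc (h z) = Num.sqrt L.
  move/circleE => z1; rewrite /h !normcM !normcV normcX z1 expr1n invr1 mulr1.
  have un : 0 < normc u.[z] by rewrite normc_gt0 u0.
  have -> : normc y.[z] = Num.sqrt L * normc u.[z].
    rewrite -[LHS]ger0_norm ?normc_ge0 // -sqrtr_sqr Ly // sqrtrM // sqrtr_sqr.
    by rewrite ger0_norm ?normc_ge0.
  by rewrite mulfK // gt_eqF.
have fqh z : circle z -> normc (f z - q.[z] - h z) < e / 2.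
  move=> zc; move/circleE: (zc) => z1.
  have zN : z ^+ N != 0 by rewrite expf_neq0 // -normc_gt0 z1.
  have sE : s.[z] / z ^+ N = h z + w.[z] * u.[z]^-1.
    have := congr1 (fun r => r.[z]) suE; rewrite !hornerE => suz.
    have -> : s.[z] = (y.[z] + w.[z] * z ^+ N) / u.[z] by rewrite -suz mulfK ?u0.
    by rewrite /h; field; rewrite u0 // zN.
  have -> : f z - q.[z] - h z =
    (f z - s.[z] / z ^+ N) + (w.[z] * u.[z]^-1 - q.[z]) by rewrite sE; ring.
  apply: le_lt_trans (le_normcD _ _) _.
  by have := fs z zc; have := wq z zc; lra.
have [Le|Le] := ltP (Num.sqrt L) (e / 2).
  exists q => z zc; have := le_normcD (f z - q.[z] - h z) (h z).
  by rewrite subrK hL //; have := fqh z zc; lra.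
exfalso; pose g (z : Cplx R) : Cplx R := f z + (- q).[z].
have gh z : circle z -> normc (g z - h z) < normc (h z).
  by move=> zc; rewrite /g hornerN hL //; have := fqh z zc; lra.
have h0 z : circle z -> h z != 0 by move=> zc; rewrite -normc_gt0 hL //; lra.
have g0 z : circle z -> g z != 0.
  by move=> zc; apply/eqP => gz; have := gh z zc; rewrite gz sub0r normcN ltxx.
have y0 z : circle z -> y.[z] != 0.
  by move=> zc; apply: contraNneq (h0 z zc) => yz; rewrite /h yz mul0r.
have [k [yk ky _]] := change_poly y0.
have u0c z : circle z -> u.[z] != 0 by move/circleE; exact: u0.
have [l [ul _ /(_ uroot) l0]] := change_poly u0c.
rewrite l0 mulr0 in ul.
have hc : is_change_of_arg h (2 * pi * k%:R + (- 0 + - (2 * pi * N%:R))).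
  exact: (change_mul yk (change_mul (change_inv ul) (change_inv (change_exp_id N)))).
have uc : ccont (fun z : Cplx R => u.[z]^-1).
  by apply: (ccontV (@ccont_horner R u)) => z /circleE; exact: u0.
have zc : ccont (fun z : Cplx R => (z ^+ N)^-1).
  have -> : (fun z : Cplx R => (z ^+ N)^-1) = (fun z => ('X^N).[z]^-1).
    by apply/funext => z; rewrite hornerXn.
  apply: (ccontV (@ccont_horner R 'X^N)) => z /circleE z1.
  by rewrite hornerXn expf_neq0 // -normc_gt0 z1.
have hcc : ccont h := ccontM (@ccont_horner R y) (ccontM uc zc).
have gcc : ccont g := ccontD (ucont_ccont fu) (@ccont_horner R (- q)).
have gc := change_near gcc hcc gh hc.
have [c gc' c0] := fP (- q) g0.
have := change_unique g0 gc gc' => cE; move: c0; rewrite -cE.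
(* The roots of [y] in the disc number [k < size y <= N], so the change [2 * pi * (k - N)] is at
   most [- 2 * pi]. *)
have kN : k%:R + 1 <= N%:R :> R by rewrite natr1 ler_nat (leq_trans ky).
have := ler_wpM2l (pi_ge0 R) kN; have := pi_gt0 R; lra.
Qed.

End ArgumentPrinciple.

Theorem theorem1p1 (R : realType) (f : Cplx R -> Cplx R)
    (hf : {within (@circle R), continuous f}) :
  extends_holomorphically f <->
  (forall P : {poly R[i]},
     (forall z : Cplx R, circle z -> f z + P.[z] != 0) ->
     exists2 c : R, is_change_of_arg (fun z => f z + P.[z]) c & 0 <= c).
Proof.
have fu := within_ucont (@circle_compact R) hf.
split=> [/approximable_of_extends fa P|fP].
  apply: approximable_change.
    move=> e e0; have e2 : 0 < e / 2 by lra.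
    have [d d0 fd] := fu _ e2; have [b b0 pb] := ucont_poly P e2.
    exists (Num.min d b); first by rewrite lt_min d0.
    move=> z w zc wc; rewrite lt_min => /andP[zd zb].
    have -> : f z + P.[z] - (f w + P.[w]) = (f z - f w) + (P.[z] - P.[w]) by ring.
    apply: le_lt_trans (le_normcD _ _) _.
    have := fd z w zc wc zd.
    by have := pb z w (circle_closed_disc zc) (circle_closed_disc wc) zb; lra.
  move=> e e0; have [p fp] := fa e e0; exists (p + P) => z zc.
  by rewrite hornerD opprD addrACA subrr addr0; exact: fp.
by apply: approximable_extends; exact: approximable_of_change.
Qed.
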